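(* There exists $\beta_0>0$, depending on $J^{neum}$ and $\Lambda$, such that for $0\le\beta\le\beta_0$ there exists a unique weak solution $\bar\rho$ of the stationary problem $$\begin{cases}\Delta\rho(u)-\beta\,\nabla\cdot\big\{\rho(u)(1-\rho(u))\nabla(J^{neum}\star\rho)(u)\big\}=0,\quad u\in\Lambda,\\ \rho(\mp1)=\rho_\mp.\end{cases}$$ Further, for $\rho_0\in\mathcal M$ let $\rho_t(\rho_0)$, $t\ge0$, be the weak solution of $$\begin{cases}\partial_t\rho_t(u)+\beta\,\nabla\cdot\big\{\rho_t(u)(1-\rho_t(u))\nabla(J^{neum}\star\rho_t)(u)\big\}=\Delta\rho_t(u),\quad t>0,\ u\in\Lambda,\\ \rho_t(\mp1)=\rho_\mp,\end{cases}$$ with initial datum $\rho_0$. For $\beta<\beta_0$ there exists $c(\beta)>0$ such that for all $\rho_0\in\mathcal M$ and $t\ge0$ $$\|\rho_t(\rho_0)-\bar\rho\|_{L^2(\Lambda)}\le e^{-c(\beta)t}\|\rho_0-\bar\rho\|_{L^2(\Lambda)}.$$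
   Context: $\Lambda=(-1,1)$, $\rho_-,\rho_+\in(0,1)$. $J:\mathbb R\times\mathbb R\to[0,\infty)$ is a smooth, symmetric, translation invariant probability kernel of range 1: $J(u,v)=J(0,v-u)$, $J(0,u)=0$ for $|u|>1$, $\int J(u,v)\,dv=1$. Set $J^{neum}(u,v)=J(u,v)+J(u,2-v)+J(u,-2-v)$ and $(J^{neum}\star m)(u)=\int_\Lambda J^{neum}(u,v)m(v)\,dv$. $\mathcal M=\{\rho\in L^\infty([-1,1]):0\le\rho\le1\}$ with the topology of weak convergence (tested against continuous functions on $[-1,1]$); $D([0,T],\mathcal M)$ is the space of right continuous trajectories with left limits. $\langle f,g\rangle=\int_\Lambda fg\,du$, $\nabla,\Delta$ are derivatives in $u$, $\sigma(\rho)=2\rho(1-\rho)$. $C^{1,2}_0([0,T]\times[-1,1])$ is the set of functions $G_t(u)$ with one time and two space derivatives continuous up to the boundary and $G_t(\pm1)=0$; $C_0^2([-1,1])$ is the set of $C^2$ functions on $[-1,1]$ vanishing at $\pm1$. A weak solution of the evolution problem with initial datum $\gamma\in\mathcal M$ is a $\rho$ such that for every $T>0$, $\rho\in D([0,T],\mathcal M)\cap L^2([0,T],H^1(\Lambda))$ and for every $G\in C_0^{1,2}([0,T]\times[-1,1])$ $$\langle\rho_T,G_T\rangle-\langle\gamma,G_0\rangle-\int_0^T\langle\rho_t,\partial_tG_t\rangle dt-\int_0^T\langle\rho_t,\Delta G_t\rangle dt+\rho_+\int_0^T\nabla G_t(1)dt-\rho_-\int_0^T\nabla G_t(-1)dt-\frac\beta2\int_0^T\langle\sigma(\rho_t),\nabla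 G_t\cdot\nabla(J^{neum}\star\rho_t)\rangle dt=0.$$ Such a solution exists and is unique. A weak solution of the stationary problem is a $\rho\in H^1(\Lambda)$ with $0\le\rho\le1$ such that for every $G\in C_0^2([-1,1])$ $$-\langle\rho,\Delta G\rangle+\rho_+\nabla G(1)-\rho_-\nabla G(-1)-\frac\beta2\langle\sigma(\rho),\nabla G\cdot\nabla(J^{neum}\star\rho)\rangle=0.$$ *)

(* Defs.v *)
From HB Require Import structures.
From mathcomp Require Import all_boot all_order all_algebra.
From mathcomp Require Import all_classical all_reals all_analysis.

Set Implicit Arguments.
Unset Strict Implicit.
Unset Printing Implicit Defensive.

Import Order.TTheory GRing.Theory Num.Theory.
Import numFieldNormedType.Exports.

Local Open Scope classical_set_scope.
Local Open Scope ring_scope.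

(* Elements of L^oo, L^2 and H^1 are handled through representatives R -> R,
   whose values outside the domain are irrelevant; two representatives denote
   the same element when they are a.e. equal there. *)

Section Defs.
Context {R : realType}.
Local Notation mu := (@lebesgue_measure R).

Definition Lambda : set R := `]-1, 1[.
Definition Lambda_bar : set R := `[-1, 1].

Definition inner (f g : R -> R) : R := \int[mu]_(u in Lambda) (f u * g u).

Definition L2norm (f : R -> R) : \bar R := 'N[mu]_2%:E[EFin \o (f \_ Lambda)].

Definition L2 (f : R -> R) : Prop :=
  measurable_fun Lambda f /\ (L2norm f < +oo)%E.

(* C^oo on R^2: D i j is the partial derivative of order i in the first
   variable and j in the second one. *)
Definition smooth2 (f : R -> R -> R) : Prop :=
  exists D : nat -> nat -> R -> R -> R,
    (forall u v, D 0%N 0%N u v = f u v) /\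
    forall i j,
      [/\ continuous (fun p : R * R => D i j p.1 p.2),
          forall u v : R, is_derive u (1 : R) (fun x => D i j x v) (D i.+1 j u v) &
          forall u v : R, is_derive v (1 : R) (fun y => D i j u y) (D i j.+1 u v)].

Definition probability_kernel (J : R -> R -> R) : Prop :=
  (forall u v, 0 <= J u v) /\
  (forall u, (\int[mu]_v (J u v)%:E = 1)%E).

Definition admissible_kernel (J : R -> R -> R) : Prop :=
  [/\ smooth2 J,
      probability_kernel J,
      forall u v, J u v = J v u,
      forall u v, J u v = J 0 (v - u) &
      forall u : R, 1 < `|u| -> J 0 u = 0].

Definition Jneum (J : R -> R -> R) (u v : R) : R :=
  J u v + J u (2 - v) + J u (- 2 - v).

Definition Jstar (J : R -> R -> R) (m : R -> R) (u : R) : R :=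
  \int[mu]_(v in Lambda) (Jneum J u v * m v).

Definition sigma (r : R) : R := 2 * r * (1 - r).

Definition test_function (phi : R -> R) : Prop :=
  (forall n (x : R), derivable (derive1n n phi) x (1 : R)) /\
  exists2 K : set R, compact K /\ K `<=` Lambda &
    forall x, ~ K x -> phi x = 0.

Definition weak_derivative (f g : R -> R) : Prop :=
  forall phi, test_function phi ->
    inner f (derive1 phi) = - inner g phi.

(* f belongs to H^1(Lambda) and g is its gradient. *)
Definition H1_grad (f g : R -> R) : Prop :=
  [/\ L2 f, L2 g & weak_derivative f g].

Definition H1 (f : R -> R) : Prop := exists g, H1_grad f g.

Definition in_M (rho : R -> R) : Prop :=
  measurable_fun Lambda_bar rho /\
  {ae mu, forall u, Lambda_bar u -> 0 <= rho u <= 1}.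

(* Convergence of rho along F to m in the topology of the state space. *)
Definition weak_cvg (F : set_system R) (rho : R -> R -> R) (m : R -> R) : Prop :=
  forall phi : R -> R, {within Lambda_bar, continuous phi} ->
    inner (rho s) phi @[s --> F] --> inner m phi.

Definition cadlag_M (T : R) (rho : R -> R -> R) : Prop :=
  [/\ forall t : R, 0 <= t <= T -> in_M (rho t),
      forall t : R, 0 <= t < T -> weak_cvg t^'+ rho (rho t) &
      forall t : R, 0 < t <= T -> exists2 m, in_M m & weak_cvg t^'- rho m].

(* L^2([0,T], H^1(Lambda)); r is a jointly measurable version of rho and d of
   its space gradient. *)
Definition L2H1 (T : R) (rho : R -> R -> R) : Prop :=
  exists r d : R -> R -> R,
    [/\ measurable_fun ((`[0, T] : set R) `*` Lambda) (fun p : R * R => r p.1 p.2),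
        measurable_fun ((`[0, T] : set R) `*` Lambda) (fun p : R * R => d p.1 p.2),
        {ae mu, forall t : R, 0 <= t <= T ->
           rho t = r t %[ae mu in Lambda] /\ H1_grad (r t) (d t)} &
        (\int[mu]_(t in `[0%R, T]) (L2norm (r t) ^+ 2 + L2norm (d t) ^+ 2)
           < +oo)%E].

(* G1 and G2 are the continuous extensions to [-1,1] of G' and G''. *)
Definition C2_0 (G G1 G2 : R -> R) : Prop :=
  [/\ {within Lambda_bar, continuous G},
      {within Lambda_bar, continuous G1} &
      {within Lambda_bar, continuous G2}] /\
  [/\ forall u : R, Lambda u -> is_derive u (1 : R) G (G1 u),
      forall u : R, Lambda u -> is_derive u (1 : R) G1 (G2 u) &
      G (-1) = 0 /\ G 1 = 0].

(* Likewise, Gt, G1 and G2 are the continuous extensions to [0,T] x [-1,1] of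
   the time derivative and of the first two space derivatives of G. *)
Definition C12_0 (T : R) (G Gt G1 G2 : R -> R -> R) : Prop :=
  let Q : set (R * R) := (`[0, T] : set R) `*` Lambda_bar in
  [/\ {within Q, continuous (fun p : R * R => G p.1 p.2)},
      {within Q, continuous (fun p : R * R => Gt p.1 p.2)},
      {within Q, continuous (fun p : R * R => G1 p.1 p.2)} &
      {within Q, continuous (fun p : R * R => G2 p.1 p.2)}] /\
  [/\ forall t u : R, 0 < t < T -> Lambda u ->
        is_derive t (1 : R) (fun s => G s u) (Gt t u),
      forall t u : R, 0 < t < T -> Lambda u -> is_derive u (1 : R) (G t) (G1 t u),
      forall t u : R, 0 < t < T -> Lambda u -> is_derive u (1 : R) (G1 t) (G2 t u) &
      forall t : R, 0 <= t <= T -> G t (-1) = 0 /\ G t 1 = 0].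

Definition stationary_solution (J : R -> R -> R) (beta rhom rhop : R)
    (rho : R -> R) : Prop :=
  [/\ H1 rho,
      {ae mu, forall u, Lambda u -> 0 <= rho u <= 1} &
      forall G G1 G2, C2_0 G G1 G2 ->
        - inner rho G2 + rhop * G1 1 - rhom * G1 (-1)
        - beta / 2 * inner (fun u => sigma (rho u))
                           (fun u => G1 u * derive1 (Jstar J rho) u) = 0].

Definition evolution_solution (J : R -> R -> R) (beta rhom rhop : R)
    (gamma : R -> R) (rho : R -> R -> R) : Prop :=
  forall T : R, 0 < T ->
  [/\ cadlag_M T rho,
      L2H1 T rho &
      forall G Gt G1 G2, C12_0 T G Gt G1 G2 ->
        inner (rho T) (G T) - inner gamma (G 0)
        - \int[mu]_(t in `[0, T]) inner (rho t) (Gt t)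
        - \int[mu]_(t in `[0, T]) inner (rho t) (G2 t)
        + rhop * \int[mu]_(t in `[0, T]) G1 t 1
        - rhom * \int[mu]_(t in `[0, T]) G1 t (-1)
        - beta / 2 * \int[mu]_(t in `[0, T])
            inner (fun u => sigma (rho t u))
                  (fun u => G1 t u * derive1 (Jstar J (rho t)) u) = 0].

End Defs.

(* Main.v *)
(* Test both weak formulations against the Dirichlet eigenfunctions
   e_k(u) = sin(k pi (u+1)/2), k >= 1, and let a_k be the coefficients of
   w = rho_t - rhobar. Then a_k' = - l_k^2 a_k + l_k d_k, where l_k = k pi/2 >= 1
   and d_k is the coefficient of beta/2 times the difference of the fluxes
   sigma(rho) grad(J * rho) on the cosine e_k'/l_k. Hence
   (a_k^2)' <= - a_k^2 + d_k^2. Summing over k, Parseval for the sines and Bessel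
   for the cosines give (|w|^2)' <= - |w|^2 + |d|^2, and the flux is Lipschitz in
   L^2, so |d|^2 <= |w|^2 / 2 for small beta: |w|^2 decays exponentially. In the
   stationary case the same identity reads l_k a_k = d_k and yields uniqueness.

   The sines are complete because sin(t) p(cos t) is a sine sum for every
   polynomial p, and Bernstein polynomials approximate.

   A stationary solution is a fixed point of the integrated equation, a sup-norm
   contraction once sigma is truncated outside [0,1]; where the solution leaves
   [0,1] the truncated equation reduces to rho' = constant, which the boundary
   values exclude. *)
Require Import Defs.
From mathcomp Require Import all_boot all_order all_algebra.
From mathcomp Require Import all_classical all_reals all_analysis.
From mathcomp Require Import measurable_realfun ring lra zify.
Import Order.TTheory GRing.Theory Num.Theory.
Import numFieldNormedType.Exports.
Local Open Scope classical_set_scope.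
Local Open Scope ring_scope.
Set Implicit Arguments.
Unset Strict Implicit.
Unset Printing Implicit Defensive.

(** * Bounded measurable functions and the inner product *)

(** The difference of two solutions is not an admissible test function, so the energy inequality
    cannot be read off by testing with it. A fixed eigenfunction is admissible and turns the weak
    formulation into a scalar integral equation with bounded right-hand side; squaring that equation
    and summing over modes takes the place of a chain rule in a dual Sobolev space. The weak form
    pairs the flux with the gradient of the test function, hence with cosines, so the flux is never
    differentiated.

    Functions are only known almost everywhere. Truncation to [0,1] provides representatives with
    pointwise bounds, and bounded measurable functions on a set of finite measure form an algebra of
    integrable functions, in which nearly every computation takes place.

    The kernel enters only through its gradient [K] and a bound [B] of |K| on a square larger than
    the domain. The smallness condition on [beta] is dictated by the fixed-point argument; the L2
    estimates hold with room to spare. *)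

Definition bounded_measurable {R : realType} (D : set R) (f : R -> R) :=
  measurable_fun D f /\ exists M : R, forall x, D x -> `|f x| <= M.

Section BoundedMeasurable.
Context {R : realType}.
Local Notation mu := (@lebesgue_measure R).
Implicit Types (D : set R) (f g : R -> R).
Local Notation bm := bounded_measurable.

Lemma bm_cst D c : bm D (cst c).
Proof. by split; [exact: measurable_cst | exists `|c|]. Qed.

Lemma bmD D f g : bm D f -> bm D g -> bm D (fun x => f x + g x).
Proof.
move=> [mf [M HM]] [mg [N HN]]; split; first exact: measurable_funD.
by exists (M + N) => x Dx; rewrite (le_trans (ler_normD _ _))// lerD ?HM ?HN.
Qed.

Lemma bmM D f g : bm D f -> bm D g -> bm D (fun x => f x * g x).
Proof.
move=> [mf [M HM]] [mg [N HN]]; split; first exact: measurable_funM.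
by exists (M * N) => x Dx; rewrite normrM ler_pM ?HM ?HN.
Qed.

Lemma bmZ D c f : bm D f -> bm D (fun x => c * f x).
Proof. by move=> bf; apply: bmM => //; exact: bm_cst. Qed.

Lemma bmN D f : bm D f -> bm D (fun x => - f x).
Proof.
move=> [mf [M HM]]; split; first exact: measurableT_comp.
by exists M => x Dx; rewrite normrN HM.
Qed.

Lemma bmB D f g : bm D f -> bm D g -> bm D (fun x => f x - g x).
Proof. by move=> bf bg; apply: bmD => //; exact: bmN. Qed.

Lemma bm_sum D I (r : seq I) (f : I -> R -> R) :
  (forall i, bm D (f i)) -> bm D (fun x => \sum_(i <- r) f i x).
Proof.
move=> bf; elim: r => [|i r IH].
  by under eq_fun do rewrite big_nil; exact: bm_cst.
by under eq_fun do rewrite big_cons; exact: bmD.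
Qed.

Lemma bmX2 D f : bm D f -> bm D (fun x => f x ^+ 2).
Proof. by move=> bf; exact: bmM. Qed.

Lemma bm_subset D E f : measurable D -> E `<=` D -> bm D f -> bm E f.
Proof.
move=> mD ED [mf [M HM]]; split; first exact: measurable_funS mf.
by exists M => x /ED; exact: HM.
Qed.

Lemma bm_ext D f g : {in D, f =1 g} -> bm D f -> bm D g.
Proof.
move=> fg [mf [M HM]]; split; first exact: eq_measurable_fun mf.
by exists M => x Dx; rewrite -fg ?inE//; exact: HM.
Qed.

Lemma bm_integrable D f : measurable D -> (mu D < +oo)%E -> bm D f ->
  mu.-integrable D (EFin \o f).
Proof.
move=> mD fD [mf [M HM]]; apply: measurable_bounded_integrable => //.
exists M; split; first exact: num_real.
by move=> x Mx y Dy; apply: le_trans (HM _ Dy) (ltW Mx).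
Qed.

Lemma continuous_bm (a b : R) f : {within `[a, b], continuous f} -> bm `[a, b] f.
Proof.
move=> cf; split; first exact: subspace_continuous_measurable_fun.
have /compact_bounded[M [_ mrt]] := continuous_compact cf (@segment_compact _ a b).
exists (M + 1) => x Dx; apply: (mrt (M + 1)); first by rewrite ltrDl.
by exists x.
Qed.

(** Dominated convergence, with the constant [M] as dominating function on a set of finite
    measure. *)
Lemma bounded_cvg_Rintegral D (f_ : nat -> R -> R) f (M : R) :
  measurable D -> (mu D < +oo)%E ->
  (forall n, measurable_fun D (f_ n)) -> measurable_fun D f ->
  (forall n x, D x -> `|f_ n x| <= M) ->
  (forall x, D x -> f_ n x @[n --> \oo] --> f x) ->
  \int[mu]_(x in D) f_ n x @[n --> \oo] --> \int[mu]_(x in D) f x.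
Proof.
move=> mD fD mf_ mf bf cf.
have h1 n : measurable_fun D (EFin \o f_ n) by exact/measurable_EFinP.
have h2 : measurable_fun D (EFin \o f) by exact/measurable_EFinP.
have h3 : {ae mu, forall x, D x -> (EFin \o f_ n) x @[n --> \oo] --> (EFin \o f) x}.
  by apply: aeW => x Dx; apply: cvg_EFin; [exact: nearW | exact: cf].
have h4 : mu.-integrable D (cst M%:E) by apply: bm_integrable => //; exact: bm_cst.
have h5 : {ae mu, forall x n, D x -> (`|(EFin \o f_ n) x| <= cst M%:E x)%E}.
  by apply: aeW => x n Dx; rewrite lee_fin bf.
have [intf _ cvgf] :=
  @dominated_convergence _ (measurableTypeR R) R mu D mD _ _ _ h1 h2 h3 h4 h5.
apply: fine_cvg; rewrite fineK//.
by apply: integrable_fin_num.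
Qed.

End BoundedMeasurable.

(** * Integrals of almost everywhere equal functions *)

Section AeIntegral.
Context d (T : measurableType d) (R : realType) (mu : {measure set T -> \bar R}).
Import HBNNSimple.

(** The integral of a nonnegative function is a supremum over simple functions below it. A simple
    function below [f], set to 0 on the exceptional null set [N], lies below [g] and keeps its
    integral, so measurability of [f] and [g] never enters. *)
Let ge0_ae_le_integral_nomeas (f g : T -> \bar R) :
  (forall x, 0 <= f x)%E -> (forall x, 0 <= g x)%E -> f = g %[ae mu] ->
  (\int[mu]_x f x <= \int[mu]_x g x)%E.
Proof.
move=> f0 g0 [N [mN N0 subN]].
have fgN x : ~ N x -> f x = g x.
  by move=> Nx; apply: contrapT => fg; apply/Nx/subN => /= /(_ I).
rewrite [leLHS]ge0_integralTE// [leRHS]ge0_integralTE//.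
apply: ge_ereal_sup => _ /= [h hf <-].
have mNC : measurable (~` N) by exact: measurableC.
have -> : sintegral mu h = sintegral mu (proj_nnsfun h mNC).
  rewrite -!integralT_nnsfun; apply: ge0_ae_eq_integral => //.
  - by apply/measurable_EFinP.
  - by apply/measurable_EFinP.
  - by move=> x _; rewrite lee_fin.
  - by move=> x _; rewrite lee_fin.
  - exists N; split => // x /= /not_implyP[_ hx]; apply: contrapT => Nx.
    by apply: hx; rewrite mindicE mem_set//= mulr1.
apply: ereal_sup_ubound; exists (proj_nnsfun h mNC) => // x /=.
rewrite mindicE; have [xN|xN] := boolP (x \in ~` N).
  by rewrite mulr1 -fgN//; move: xN; rewrite inE.
by rewrite mulr0.
Qed.

(* The Borel structure is not complete, so a function a.e. equal to a measurable
   one need not be measurable and [ae_eq_integral] does not cover the time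
   integrals of the weak formulation. *)
Lemma ae_eq_integral_nomeas (D : set T) (f g : T -> \bar R) :
  f = g %[ae mu in D] -> (\int[mu]_(x in D) f x = \int[mu]_(x in D) g x)%E.
Proof.
move=> fg.
have fgD : f \_ D = g \_ D %[ae mu].
  by apply: filterS fg => x fgx _; rewrite !patchE; case: ifPn => //; rewrite inE.
have fgDp : (f \_ D)^\+%E = (g \_ D)^\+%E %[ae mu].
  by apply: filterS fgD => x /(_ I) fgx _; rewrite !funeposE fgx.
have fgDn : (f \_ D)^\-%E = (g \_ D)^\-%E %[ae mu].
  by apply: filterS fgD => x /(_ I) fgx _; rewrite !funenegE fgx.
rewrite integral_mkcond [RHS]integral_mkcond integralE [RHS]integralE.
congr (_ - _)%E; apply/eqP; rewrite eq_le;
  rewrite !ge0_ae_le_integral_nomeas//; by [exact: ae_eq_sym|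
  move=> x; exact: funepos_ge0|move=> x; exact: funeneg_ge0].
Qed.

Lemma ae_eq_Rintegral (D : set T) (f g : T -> R) :
  f = g %[ae mu in D] -> \int[mu]_(x in D) f x = \int[mu]_(x in D) g x.
Proof.
move=> fg; congr fine; apply: ae_eq_integral_nomeas.
by apply: filterS fg => x fgx Dx /=; rewrite fgx.
Qed.

End AeIntegral.

(** * The inner product on bounded measurable functions *)

Section Inner.
Context {R : realType}.
Local Notation mu := (@lebesgue_measure R).
Local Notation L := (@Lambda R).
Implicit Types (f g h : R -> R).
Local Notation bm := bounded_measurable.

#[global] Instance lebesgue_ae_filter : Filter (nbhs (almost_everywhere mu)).
Proof. exact: (@ae_filter_ringOfSetsType _ (measurableTypeR R)). Qed.

Lemma measurable_Lambda : measurable L.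
Proof. exact: measurable_itv. Qed.

Lemma mu_Lambda : mu L = 2%:E.
Proof.
rewrite /Lambda lebesgue_measure_itv/= lte_fin (_ : -1 < 1 :> R) /=; last by lra.
by rewrite -EFinD opprK.
Qed.

Lemma bmL_integrable f : bm L f -> mu.-integrable L (EFin \o f).
Proof.
move=> bf; apply: bm_integrable => //; first exact: measurable_Lambda.
by rewrite mu_Lambda ltry.
Qed.

Lemma innerC f g : inner f g = inner g f.
Proof. by apply: eq_Rintegral => x _; rewrite mulrC. Qed.

Lemma innerDr f g h : bm L f -> bm L g -> bm L h ->
  inner f (fun x => g x + h x) = inner f g + inner f h.
Proof.
move=> bf bg bh; rewrite /inner -RintegralD//; first last.
- exact/bmL_integrable/bmM.
- exact/bmL_integrable/bmM.
- exact: measurable_Lambda.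
by apply: eq_Rintegral => x _; rewrite mulrDr.
Qed.

Lemma innerZr f c g : bm L f -> bm L g ->
  inner f (fun x => c * g x) = c * inner f g.
Proof.
move=> bf bg; rewrite /inner -RintegralZl//; first last.
- exact/bmL_integrable/bmM.
- exact: measurable_Lambda.
by apply: eq_Rintegral => x _; rewrite mulrCA.
Qed.

Lemma innerNr f g : bm L f -> bm L g -> inner f (fun x => - g x) = - inner f g.
Proof.
move=> bf bg; rewrite -mulN1r -innerZr//.
by apply: eq_Rintegral => x _; rewrite mulN1r.
Qed.

Lemma innerBr f g h : bm L f -> bm L g -> bm L h ->
  inner f (fun x => g x - h x) = inner f g - inner f h.
Proof. by move=> bf bg bh; rewrite innerDr ?innerNr//; exact: bmN. Qed.

Lemma innerDl f g h : bm L f -> bm L g -> bm L h ->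
  inner (fun x => f x + g x) h = inner f h + inner g h.
Proof. by move=> ? ? ?; rewrite innerC innerDr// !(innerC h). Qed.

Lemma innerBl f g h : bm L f -> bm L g -> bm L h ->
  inner (fun x => f x - g x) h = inner f h - inner g h.
Proof. by move=> ? ? ?; rewrite innerC innerBr// !(innerC h). Qed.

Lemma inner_sumr f I (r : seq I) (g : I -> R -> R) : bm L f ->
  (forall i, bm L (g i)) ->
  inner f (fun x => \sum_(i <- r) g i x) = \sum_(i <- r) inner f (g i).
Proof.
move=> bf bg; elim: r => [|i r IH].
  rewrite big_nil /inner; under eq_Rintegral do rewrite big_nil mulr0.
  by rewrite Rintegral_cst ?mul0r//; exact: measurable_Lambda.
rewrite big_cons -IH -innerDr//; last exact: bm_sum.
by apply: eq_Rintegral => x _; rewrite big_cons.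
Qed.

Lemma inner_ge0 f : 0 <= inner f f.
Proof. by apply: Rintegral_ge0 => x _; rewrite -expr2 sqr_ge0. Qed.

Lemma ae_eq_inner f f' g g' : f = f' %[ae mu in L] -> g = g' %[ae mu in L] ->
  inner f g = inner f' g'.
Proof.
move=> ff' gg'; apply: ae_eq_Rintegral.
by apply: (filterS2 _ _ ff' gg') => x h1 h2 Lx; rewrite h1// h2.
Qed.

Lemma ae_eq_inner0 f : bm L f -> inner f f = 0 -> f = cst 0 %[ae mu in L].
Proof.
move=> bf; rewrite /inner /Rintegral => i0.
have fin : (\int[mu]_(u in L) (f u * f u)%:E)%E \is a fin_num.
  apply: integrable_fin_num; first exact: measurable_Lambda.
  exact/bmL_integrable/bmM.
have mff : measurable_fun L (EFin \o (fun x => f x * f x)).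
  by apply/measurable_EFinP; case: (bmM bf bf).
have [+ _] := @ae_eq_integral_abs _ (measurableTypeR R) R mu L measurable_Lambda _ mff.
have -> : (\int[mu]_(x in L) `|(EFin \o (fun x => f x * f x)%R) x|)%E = 0%E.
  rewrite -[RHS]/(0%:E) -i0 fineK//.
  apply: eq_integral => x _ /=; rewrite ger0_norm// -expr2; exact: sqr_ge0.
move=> /(_ erefl); apply: filterS => x /= h Lx; have [] := h Lx.
by move=> /eqP; rewrite mulf_eq0 orbb => /eqP.
Qed.

(** The bridge from the extended-real norm of the statement to [inner]: [f] may be any function that
    has a bounded measurable representative [g]. *)
Lemma L2normE f g : f = g %[ae mu in L] -> bm L g ->
  L2norm f = (Num.sqrt (inner g g))%:E.
Proof.
move=> fg bg; rewrite /L2norm unlock /=.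
have -> : (\int[mu]_x `|((f \_ L) x)%:E| `^ 2 = \int[mu]_(x in L) (g x * g x)%:E)%E.
  rewrite [RHS]integral_mkcond; apply: ae_eq_integral_nomeas.
  apply: filterS fg => x fgx _ /=; rewrite !patchE.
  case: ifPn => [|_]; last by rewrite /= normr0 powR0.
  rewrite inE => /fgx -> /=; rewrite powR_mulrn ?normr_ge0//.
  by rewrite real_normK ?num_real// expr2.
rewrite -(_ : (inner g g)%:E = \int[mu]_(x in L) (g x * g x)%:E)%E; last first.
  rewrite /inner /Rintegral fineK//; apply: integrable_fin_num.
    exact: measurable_Lambda.
  exact/bmL_integrable/bmM.
by rewrite poweR_EFin powR12_sqrt ?inner_ge0.
Qed.

End Inner.

(** * The Dirichlet sine basis *)

Section CalculusOnLambda.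
Context {R : realType}.
Local Notation mu := (@lebesgue_measure R).
Local Notation L := (@Lambda R).
Local Notation Lb := (@Lambda_bar R).
Implicit Types (f g F G : R -> R).
Local Notation bm := bounded_measurable.

Lemma ltN11 : -1 < 1 :> R. Proof. by lra. Qed.

Lemma Lambda_subset : L `<=` Lb.
Proof. exact: subset_itv_oo_cc. Qed.

Lemma within_continuous_bm f : {within Lb, continuous f} -> bm L f.
Proof.
move=> /continuous_bm; apply: bm_subset Lambda_subset; exact: measurable_itv.
Qed.

Lemma continuous_bmL f : continuous f -> bm L f.
Proof. by move=> cf; apply: within_continuous_bm; exact: continuous_subspaceT. Qed.

Lemma derivable_LRcontinuous F f : {within Lb, continuous F} ->
  (forall x : R, L x -> is_derive x 1 F (f x)) ->
  derivable_oo_LRcontinuous F (-1) 1 /\ {in `]-1, 1[, derive1 F =1 f}.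
Proof.
move=> /(continuous_within_itvP _ ltN11)[_ Fl Fr] dF; split.
  by split => // x xL; have [] := dF x xL.
by move=> x xL; rewrite derive1E; have [_ ->] := dF x xL.
Qed.

(** The endpoints are null. Integration by parts lives on the closed interval, whereas [inner]
    integrates over the open one. *)
Lemma Rintegral_Lambda f : bm Lb f ->
  \int[mu]_(x in L) f x = \int[mu]_(x in Lb) f x.
Proof.
move=> bf; rewrite /Lambda /Lambda_bar.
have i1 : mu.-integrable `[(-1 : R), 1] (EFin \o f).
  apply: bm_integrable bf; first exact: measurable_itv.
  by rewrite /Lambda_bar lebesgue_measure_itv/= lte_fin ltN11 -EFinB ltry.
have i2 : mu.-integrable `[(-1 : R), 1[ (EFin \o f).
  by apply: integrableS i1 => //; exact: subset_itv_co_cc.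
have i3 : mu.-integrable `](-1 : R), 1[ (EFin \o f).
  by apply: integrableS i1 => //; exact: subset_itv_oo_cc.
by rewrite Rintegral_itv_obnd_cbnd// Rintegral_itv_bndo_bndc.
Qed.

Lemma inner_by_parts F f G g :
  {within Lb, continuous F} -> {within Lb, continuous f} ->
  (forall x : R, L x -> is_derive x 1 F (f x)) ->
  {within Lb, continuous G} -> {within Lb, continuous g} ->
  (forall x : R, L x -> is_derive x 1 G (g x)) ->
  inner F g = F 1 * G 1 - F (-1) * G (-1) - inner f G.
Proof.
move=> cF cf dF cG cg dG.
have [F1 F2] := derivable_LRcontinuous cF dF.
have [G1 G2] := derivable_LRcontinuous cG dG.
rewrite /inner !Rintegral_Lambda; last 2 first.
  by apply: bmM; exact: continuous_bm.
  by apply: bmM; exact: continuous_bm.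
exact: (Rintegration_by_parts ltN11 cf F1 F2 cg G1 G2).
Qed.

(** Integration by parts against the constant 1. *)
Lemma FTC_Lambda F f : (forall x : R, is_derive x 1 F (f x)) -> continuous f ->
  \int[mu]_(x in L) f x = F 1 - F (-1).
Proof.
move=> dF cf.
have cF : continuous F.
  by move=> x; apply/differentiable_continuous/derivable1_diffP; have [] := dF x.
have := @inner_by_parts (cst 1) (cst 0) F f; rewrite /inner.
under eq_Rintegral do rewrite mul1r.
under [X in _ - X]eq_Rintegral do rewrite mul0r.
rewrite Rintegral_cst; last exact: measurable_Lambda.
rewrite !mul1r mul0r subr0; apply => //.
- by apply: continuous_subspaceT => x; exact: cst_continuous.
- by apply: continuous_subspaceT => x; exact: cst_continuous.
- exact: continuous_subspaceT.
- exact: continuous_subspaceT.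
Qed.

End CalculusOnLambda.

Section TrigBasis.
Context {R : realType}.
Local Notation mu := (@lebesgue_measure R).
Local Notation L := (@Lambda R).
Implicit Types (f g : R -> R).
Local Notation bm := bounded_measurable.

(** The affine map of [-1,1] onto [0,pi]. Modes are indexed from 0: [sin_mode k] is the
    eigenfunction e_{k+1}, and [freq k] is l_{k+1}. *)
Definition angle (u : R) : R := pi / 2 * (u + 1).
Definition freq (k : nat) : R := k.+1%:R * (pi / 2).
Definition sin_mode (k : nat) (u : R) : R := sin (k.+1%:R * angle u).
Definition cos_mode (k : nat) (u : R) : R := cos (k.+1%:R * angle u).

(** The spectral gap behind both uniqueness and decay; pi/2 is rounded down to 1. *)
Lemma freq_ge1 k : 1 <= freq k.
Proof.
have h := @pihalf_ge1 R.
have k1 : 1 <= k.+1%:R :> R by rewrite ler1n.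
by rewrite /freq; nra.
Qed.

Lemma is_derive_multiple_angle (a x : R) :
  is_derive x 1 (fun u => a * angle u) (a * (pi / 2)).
Proof.
rewrite /angle; apply: is_derive_eq.
by rewrite /GRing.scale /= addr0 mulr1.
Qed.

Lemma is_derive_sin_multiple (a x : R) :
  is_derive x 1 (fun u => sin (a * angle u)) (a * (pi / 2) * cos (a * angle x)).
Proof.
have h1 := is_derive_multiple_angle a x.
have h2 := is_derive_sin (a * angle x).
apply: is_derive_eq (@is_derive1_comp _ sin (fun u => a * angle u) x _ _ h2 h1) _.
by rewrite mulrC.
Qed.

Lemma is_derive_cos_multiple (a x : R) :
  is_derive x 1 (fun u => cos (a * angle u)) (- (a * (pi / 2) * sin (a * angle x))).
Proof.
have h1 := is_derive_multiple_angle a x.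
have h2 := is_derive_cos (a * angle x).
apply: is_derive_eq (@is_derive1_comp _ cos (fun u => a * angle u) x _ _ h2 h1) _.
by rewrite mulNr mulrC.
Qed.

Lemma is_derive_sin_mode k (x : R) :
  is_derive x 1 (sin_mode k) (freq k * cos_mode k x).
Proof. exact: is_derive_sin_multiple. Qed.

Lemma is_derive_cos_mode k (x : R) :
  is_derive x 1 (cos_mode k) (- (freq k * sin_mode k x)).
Proof. exact: is_derive_cos_multiple. Qed.

Lemma is_derive_continuous (F f : R -> R) :
  (forall x : R, is_derive x 1 F (f x)) -> continuous F.
Proof.
by move=> dF x; apply/differentiable_continuous/derivable1_diffP; have [] := dF x.
Qed.

Lemma continuous_cos_multiple (a : R) : continuous (fun u => cos (a * angle u)).
Proof. by apply: is_derive_continuous => x; exact: is_derive_cos_multiple. Qed.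

Lemma continuous_sin_mode k : continuous (sin_mode k).
Proof. by apply: is_derive_continuous => x; exact: is_derive_sin_mode. Qed.

Lemma continuous_cos_mode k : continuous (cos_mode k).
Proof. exact: continuous_cos_multiple. Qed.

Lemma bm_sin_mode k : bm L (sin_mode k).
Proof. by apply: continuous_bmL; exact: continuous_sin_mode. Qed.

Lemma bm_cos_mode k : bm L (cos_mode k).
Proof. by apply: continuous_bmL; exact: continuous_cos_mode. Qed.

Lemma sin_pi_nat n : sin (n%:R * pi) = 0 :> R.
Proof.
elim: n => [|n IH]; first by rewrite mul0r sin0.
by rewrite -natr1 mulrDl mul1r sinDpi IH oppr0.
Qed.

Lemma angle1 : angle 1 = pi :> R.
Proof. by rewrite /angle -[X in _ * X]/(2 : R) mulfVK. Qed.

Lemma angleN1 : angle (-1) = 0 :> R.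
Proof. by rewrite /angle addNr mulr0. Qed.

Lemma sin_mode_boundary k : sin_mode k (-1) = 0 /\ sin_mode k 1 = 0.
Proof. by rewrite /sin_mode angle1 angleN1 mulr0 sin0 sin_pi_nat. Qed.

Lemma integral_cos_multiple n :
  \int[mu]_(u in L) cos (n%:R * angle u) = if n == 0%N then 2 else 0 :> R.
Proof.
case: n => [|n] /=.
  under eq_Rintegral do rewrite mul0r cos0.
  rewrite Rintegral_cst; last exact: measurable_Lambda.
  by rewrite mul1r -[X in fine X]/(mu L) mu_Lambda.
have f0 : freq n != 0 by rewrite gt_eqF// (lt_le_trans _ (freq_ge1 n)).
have dF (x : R) : is_derive x 1 (fun u => (freq n)^-1 * sin (n.+1%:R * angle u))
    (cos (n.+1%:R * angle x)).
  have h := is_derive_sin_multiple n.+1%:R x.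
  by apply: is_derive_eq; rewrite /GRing.scale /= -/(freq n) mulrA mulVf// mul1r.
rewrite (FTC_Lambda dF (@continuous_cos_multiple _)).
by rewrite angle1 angleN1 sin_pi_nat !mulr0 sin0 mulr0 subr0.
Qed.

(** The common product-to-sum form of both orthonormality relations: [s = -1] for sines, [s = 1] for
    cosines. The difference of frequencies is written [maxn m n - minn m n] to stay in [nat]; it
    vanishes exactly when [m = n], while [(m + n).+2] never does. *)
Let half_sum_cos (m n : nat) (s : R) :
  \int[mu]_(u in L) (2^-1 * (cos ((maxn m n - minn m n)%:R * angle u)
    + s * cos ((m + n).+2%:R * angle u))) = (m == n)%:R.
Proof.
have bc k : bm L (fun u => cos (k%:R * angle u)).
  by apply: continuous_bmL; exact: continuous_cos_multiple.
have mL := @measurable_Lambda R.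
rewrite RintegralZl//; last by apply: bmL_integrable; apply: bmD => //; exact: bmZ.
rewrite RintegralD//; [|exact: bmL_integrable|by apply/bmL_integrable; exact: bmZ].
rewrite RintegralZl//; last exact: bmL_integrable.
rewrite !integral_cos_multiple /= mulr0 addr0.
have -> : ((maxn m n - minn m n)%N == 0%N) = (m == n).
  by rewrite subn_eq0 maxnE minnE; apply/idP/idP => [|/eqP->]; lia.
by case: eqP => _; rewrite ?mulr0// mulVf.
Qed.

Let cos_diff (m n : nat) (t : R) :
  cos (m.+1%:R * t - n.+1%:R * t) = cos ((maxn m n - minn m n)%:R * t).
Proof.
case: (leqP m n) => [mn|/ltnW mn].
  by rewrite -cosN opprB -mulrBl -natrB ?ltnS// subSS.
by rewrite -mulrBl -natrB ?ltnS// subSS.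
Qed.

Let cos_sum (m n : nat) (t : R) :
  cos (m.+1%:R * t + n.+1%:R * t) = cos ((m + n).+2%:R * t).
Proof. by rewrite -mulrDl -natrD addSn addnS. Qed.

Lemma sin_mode_orthonormal m n : inner (sin_mode m) (sin_mode n) = (m == n)%:R.
Proof.
rewrite -(half_sum_cos m n (-1)); apply: eq_Rintegral => u _.
by rewrite -cos_diff -cos_sum /sin_mode cosB cosD; field.
Qed.

Lemma cos_mode_orthonormal m n : inner (cos_mode m) (cos_mode n) = (m == n)%:R.
Proof.
rewrite -(half_sum_cos m n 1); apply: eq_Rintegral => u _.
by rewrite -cos_diff -cos_sum /cos_mode cosB cosD; field.
Qed.

End TrigBasis.

(** * Finite orthonormal expansions and Bessel's inequality *)

Section Bessel.
Context {R : realType}.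
Local Notation L := (@Lambda R).
Local Notation bm := bounded_measurable.
Variable e : nat -> R -> R.
Hypothesis be : forall k, bm L (e k).
Hypothesis oe : forall m n, inner (e m) (e n) = (m == n)%:R.

(** Pythagoras: the residual of the projection plus the error in the coefficients. Taking [c] to be
    the coefficients of [w] gives Bessel; an arbitrary [c] shows that the projection is the best
    approximation. *)
Lemma sqr_dist_orthonormal (w : R -> R) (c : nat -> R) N : bm L w ->
  let s u := \sum_(k < N) c k * e k u in
  inner (fun u => w u - s u) (fun u => w u - s u) =
  inner w w - \sum_(k < N) inner w (e k) ^+ 2
    + \sum_(k < N) (inner w (e k) - c k) ^+ 2.
Proof.
move=> bw s.
have bce k : bm L (fun u => c k * e k u) by exact: bmZ.
have bs : bm L s by exact: bm_sum.
have ws : inner w s = \sum_(k < N) c k * inner w (e k).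
  by rewrite inner_sumr//; apply: eq_bigr => k _; rewrite innerZr.
have se k : (k < N)%N -> inner s (e k) = c k.
  move=> kN; rewrite innerC inner_sumr//.
  rewrite (bigD1 (Ordinal kN))//= innerZr// oe eqxx mulr1 big1 ?addr0// => i ik.
  rewrite innerZr// oe; case: eqP => [ki|_]; last by rewrite mulr0.
  by move: ik; rewrite -val_eqE /= ki eqxx.
have ss : inner s s = \sum_(k < N) c k ^+ 2.
  rewrite inner_sumr//; apply: eq_bigr => k _.
  by rewrite innerZr// se.
rewrite innerBr//; last exact: bmB.
rewrite !innerBl// [inner s w]innerC ws ss.
have -> : \sum_(k < N) (inner w (e k) - c k) ^+ 2 =
  \sum_(k < N) inner w (e k) ^+ 2 - \sum_(k < N) c k * inner w (e k) - (\sum_(k < N) c k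
    * inner w (e k) - \sum_(k < N) c k ^+ 2).
  by rewrite -!sumrB; apply: eq_bigr => k _; ring.
by ring.
Qed.

Lemma bessel (w : R -> R) N : bm L w ->
  \sum_(k < N) inner w (e k) ^+ 2 <= inner w w.
Proof.
move=> bw; have /= sE := sqr_dist_orthonormal (fun k => inner w (e k)) N bw.
have := inner_ge0 (fun u => w u - \sum_(k < N) inner w (e k) * e k u).
rewrite sE [X in _ + X]big1 ?addr0 ?subr_ge0// => k _.
by rewrite subrr expr0n.
Qed.

End Bessel.

(** * Bernstein polynomials as binomial means *)

Section Bernstein.
Context {R : realType}.
Implicit Types (g h : nat -> R) (x : R).

(* Mean of [g] under the binomial law of parameters [n] and [x]; with
   [g j = f (j / n)] it is the [n]-th Bernstein polynomial of [f] at [x]. *)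
Fixpoint binomial_mean (n : nat) g x : R :=
  if n is m.+1 then
    (1 - x) * binomial_mean m g x + x * binomial_mean m (fun j => g j.+1) x
  else g 0%N.

Lemma binomial_meanD n g h x : binomial_mean n (fun j => g j + h j) x =
  binomial_mean n g x + binomial_mean n h x.
Proof. by elim: n g h => //= n IH g h; rewrite !IH; ring. Qed.

Lemma binomial_meanZ n c g x : binomial_mean n (fun j => c * g j) x =
  c * binomial_mean n g x.
Proof. by elim: n g => //= n IH g; rewrite !IH; ring. Qed.

Lemma binomial_mean_cst n c x : binomial_mean n (fun=> c) x = c.
Proof. by elim: n => //= n IH; rewrite !IH; ring. Qed.

(** Variance plus squared mean of the variable a j + c. The offset [c] is what lets the induction go
    through: the shift [j.+1] in the recursion becomes [a + c]. *)
Lemma binomial_mean_sqr n (a c : R) x :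
  binomial_mean n (fun j => (a * j%:R + c) ^+ 2) x =
  n%:R * a ^+ 2 * x * (1 - x) + (n%:R * a * x + c) ^+ 2.
Proof.
elim: n c => [|n IH] c /=; first by rewrite !(mul0r,mulr0,add0r).
have -> : (fun j => (a * j.+1%:R + c) ^+ 2) = (fun j => (a * j%:R + (a + c)) ^+ 2).
  by apply/funext => j; rewrite -natr1; ring.
by rewrite !IH -natr1; ring.
Qed.

Lemma binomial_mean_le n g h x : 0 <= x <= 1 -> (forall j, g j <= h j) ->
  binomial_mean n g x <= binomial_mean n h x.
Proof.
move=> x01; elim: n g h => [|n IH] g h gh /=; first exact: gh.
have h1 := IH g h gh.
have h2 := IH (fun j => g j.+1) (fun j => h j.+1) (fun j => gh j.+1).
by nra.
Qed.

Lemma binomial_mean_norm_le n g x M : 0 <= x <= 1 -> (forall j, `|g j| <= M) ->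
  `|binomial_mean n g x| <= M.
Proof.
move=> x01 gM; rewrite ler_norml -{1}(binomial_mean_cst n (- M) x).
rewrite -{2}(binomial_mean_cst n M x) !binomial_mean_le// => j;
  by have := gM j; rewrite ler_norml => /andP[].
Qed.

(** Chebyshev's argument: within [d] of [x] continuity gives eps/2, and farther away the bound 2M is
    at most K (j/n - x)^2 with K = 2M/d^2. The mean of that square is x(1-x)/n, small for large n.
    Pointwise convergence is enough, since it only feeds dominated convergence. *)
Lemma bernstein_cvg (f : R -> R) x M : 0 <= x <= 1 -> (forall y, `|f y| <= M) ->
  {for x, continuous f} ->
  binomial_mean n (fun j => f (j%:R / n%:R)) x @[n --> \oo] --> f x.
Proof.
move=> x01 fM cf.
have M0 : 0 <= M by exact: le_trans (fM 0).
apply/cvgrPdist_le => eps e0.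
move/cvgrPdist_le/(_ (eps / 2)) : cf => /(_ _)[|d /= d0 fd]; first by rewrite divr_gt0.
near=> n.
have n0 : 0 < n%:R :> R by rewrite ltr0n; near: n; exact: nbhs_infty_gt.
pose K := 2 * M / d ^+ 2.
have K0 : 0 <= K by rewrite divr_ge0 ?sqr_ge0 ?mulr_ge0.
have nK : K <= n%:R * (eps / 2).
  rewrite -ler_pdivrMr ?divr_gt0//; near: n; exact: nbhs_infty_ger.
have key j : `|f x - f (j%:R / n%:R)| <=
    K * (n%:R^-1 * j%:R + - x) ^+ 2 + eps / 2.
  have [xd|dx] := ltP `|x - j%:R / n%:R| d.
    have := fd (j%:R / n%:R) xd => h; apply: le_trans h _.
    by rewrite lerDr mulr_ge0// sqr_ge0.
  apply: (@le_trans _ _ (2 * M)).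
    by apply: le_trans (ler_normB _ _) _; have := fM x; have := fM (j%:R / n%:R); lra.
  apply: (@le_trans _ _ (K * (n%:R^-1 * j%:R - x) ^+ 2)); last by rewrite lerDl
    divr_ge0// ltW.
  rewrite /K -mulrA ler_peMr ?mulr_ge0// mulrC ler_pdivlMr ?exprn_gt0// mul1r.
  rewrite -(real_normK (num_real (n%:R^-1 * j%:R - x))).
  by apply: lerXn2r; rewrite ?nnegrE ?(ltW d0)// (mulrC n%:R^-1) distrC.
have -> : f x - binomial_mean n (fun j => f (j%:R / n%:R)) x =
    binomial_mean n (fun j => f x - f (j%:R / n%:R)) x.
  rewrite binomial_meanD binomial_mean_cst; congr (_ + _).
  rewrite -[LHS]mulN1r -binomial_meanZ; congr binomial_mean.
  by apply/funext => j; rewrite mulN1r.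
pose B j : R := K * (n%:R^-1 * j%:R + - x) ^+ 2 + eps / 2.
have BE : binomial_mean n B x <= eps.
  rewrite /B binomial_meanD binomial_mean_cst binomial_meanZ binomial_mean_sqr.
  rewrite mulfV ?gt_eqF// mul1r subrr expr0n /= addr0.
  have -> : n%:R * n%:R^-1 ^+ 2 * x * (1 - x) = n%:R^-1 * (x * (1 - x)).
    by field; rewrite gt_eqF.
  have : K * n%:R^-1 <= eps / 2 by rewrite ler_pdivrMr// mulrC.
  have : 0 <= K * n%:R^-1 by rewrite mulr_ge0// invr_ge0 ltW.
  have : 0 <= x * (1 - x) <= 1 by apply/andP; split; nra.
  by rewrite mulrA; nra.
rewrite ler_norml; apply/andP; split.
  rewrite lerNl -[leLHS]mulN1r -binomial_meanZ; apply: le_trans BE.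
  apply: binomial_mean_le => // j; rewrite mulN1r.
  by apply: le_trans (key j); rewrite -normrN ler_norm.
apply: le_trans BE; apply: binomial_mean_le => // j.
by apply: le_trans (key j); rewrite ler_norm.
Unshelve. all: by end_near. Qed.

End Bernstein.

(** * Completeness of the sines in L2 *)

Section SineCompleteness.
Context {R : realType}.
Local Notation mu := (@lebesgue_measure R).
Local Notation L := (@Lambda R).
Implicit Types (f g h w s : R -> R).
Local Notation bm := bounded_measurable.

Definition sine_sum s := exists N (c : nat -> R),
  forall u, s u = \sum_(k < N) c k * sin_mode k u.

Lemma sine_sum_widen N N' (c : nat -> R) u : (N <= N')%N ->
  \sum_(k < N) c k * sin_mode k u =
  \sum_(k < N') (if (k < N)%N then c k else 0) * sin_mode k u.
Proof.
move=> NN'; rewrite (big_ord_widen _ (fun k => c k * sin_mode k u) NN') big_mkcond.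
by apply: eq_bigr => k _; case: ifP => _; rewrite ?mul0r.
Qed.

Lemma sine_sumD s1 s2 : sine_sum s1 -> sine_sum s2 ->
  sine_sum (fun u => s1 u + s2 u).
Proof.
move=> [N1 [c1 h1]] [N2 [c2 h2]]; exists (N1 + N2)%N.
exists (fun k => (if (k < N1)%N then c1 k else 0) + (if (k < N2)%N then c2 k else 0)).
move=> u; rewrite h1 h2 (sine_sum_widen _ _ (leq_addr N2 N1)).
rewrite (sine_sum_widen _ _ (leq_addl N1 N2)) -big_split /=.
by apply: eq_bigr => k _; rewrite mulrDl.
Qed.

Lemma sine_sumZ a s : sine_sum s -> sine_sum (fun u => a * s u).
Proof.
move=> [N [c h]]; exists N, (fun k => a * c k) => u.
by rewrite h mulr_sumr; apply: eq_bigr => k _; rewrite mulrA.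
Qed.

Lemma sine_sum_mode a k : sine_sum (fun u => a * sin_mode k u).
Proof.
exists k.+1, (fun j => if j == k then a else 0) => u.
rewrite big_ord_recr /= eqxx big1 ?add0r// => j _.
by rewrite ltn_eqF// mul0r.
Qed.

Lemma sine_sum_ext s1 s2 : s1 =1 s2 -> sine_sum s1 -> sine_sum s2.
Proof. by move=> /funext ->. Qed.

Lemma sine_sum_big N (f : nat -> R -> R) : (forall k, sine_sum (f k)) ->
  sine_sum (fun u => \sum_(k < N) f k u).
Proof.
move=> hf; elim: N => [|N IH].
  apply: (@sine_sum_ext (fun u => 0 * sin_mode 0 u)); last exact: sine_sum_mode.
  by move=> u; rewrite big_ord0 mul0r.
apply: (sine_sum_ext _ (sine_sumD IH (hf N))) => u.
by rewrite big_ord_recr.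
Qed.

(* 2 cos t sin (k+1)t = sin (k+2)t + sin kt *)
Lemma sine_sum_cosM s : sine_sum s -> sine_sum (fun u => cos (angle u) * s u).
Proof.
move=> [N [c h]].
pose f k u := c k * (cos (angle u) * sin_mode k u).
apply: (@sine_sum_ext (fun u => \sum_(k < N) f k u)).
  by move=> u; rewrite h mulr_sumr; apply: eq_bigr => k _; rewrite mulrCA.
apply: sine_sum_big => k; apply: sine_sumZ.
have sE (u : R) : 2^-1 * sin_mode k.+1 u + 2^-1 * sin (k%:R * angle u) =
    cos (angle u) * sin_mode k u.
  symmetry; rewrite /sin_mode -(natr1 k.+1) -(natr1 k).
  rewrite [X in _ = _ + _ * sin X](_ : _ = (k%:R + 1) * angle u - angle u); last by ring.
  rewrite [X in _ = _ * sin X + _](_ : _ = (k%:R + 1) * angle u + angle u); last by ring.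
  by rewrite sinB sinD; field.
apply: (sine_sum_ext sE); apply: sine_sumD.
  exact: sine_sum_mode.
(* The lower neighbour of mode 0 is sin 0 = 0, which is not one of the modes. *)
case: k {f sE} => [|k]; last exact: sine_sum_mode.
apply: (sine_sum_ext _ (sine_sum_mode 0 0)) => u.
by rewrite !mul0r sin0 mulr0.
Qed.

(** At x = (1 + cos)/2 the weights x and 1 - x are (1 + cos)/2 and (1 - cos)/2, so the recursion of
    [binomial_mean] only multiplies sine sums by constants and by the cosine. The base case is a
    multiple of mode 0, which is why the factor [sin (angle u)] is present. *)
Lemma sine_sum_binomial_mean n (g : nat -> R) :
  sine_sum (fun u => sin (angle u) * binomial_mean n g ((1 + cos (angle u)) / 2)).
Proof.
elim: n g => [|n IH] g /=.
  apply: (sine_sum_ext _ (sine_sum_mode (g 0%N) 0)) => u.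
  by rewrite /sin_mode mul1r mulrC.
have h1 := sine_sumZ 2^-1 (IH g).
have h2 := sine_sumZ 2^-1 (IH (fun j => g j.+1)).
have h3 := sine_sumZ (-1) (sine_sum_cosM h1).
have h4 := sine_sum_cosM h2.
apply: (sine_sum_ext _ (sine_sumD (sine_sumD h1 h3) (sine_sumD h2 h4))) => u.
by field.
Qed.

Lemma bm_sine_sum s : sine_sum s -> bm L s.
Proof.
move=> [N [c h]]; rewrite (_ : s = fun u => \sum_(k < N) c k * sin_mode k u); last
  exact/funext.
by apply: bm_sum => k; apply: bmZ; exact: bm_sin_mode.
Qed.

Definition sqr_dist f g := inner (fun u => f u - g u) (fun u => f u - g u).

(** The pointwise inequality (x + y)^2 <= 2 (x^2 + y^2); it replaces the triangle inequality and
    avoids square roots. *)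
Lemma sqr_dist_le f g h : bm L f -> bm L g -> bm L h ->
  sqr_dist f h <= 2 * (sqr_dist f g + sqr_dist g h).
Proof.
move=> bf bg bh; rewrite /sqr_dist /inner -RintegralD//; first last.
- by apply: bmL_integrable; apply: bmM; exact: bmB.
- by apply: bmL_integrable; apply: bmM; exact: bmB.
- exact: measurable_Lambda.
rewrite -RintegralZl//; first last.
- by apply: bmL_integrable; apply: bmD; apply: bmM; exact: bmB.
- exact: measurable_Lambda.
apply: le_Rintegral => //; first exact: measurable_Lambda.
- by apply: bmL_integrable; apply: bmM; exact: bmB.
- by apply: bmL_integrable; apply: bmZ; apply: bmD; apply: bmM; exact: bmB.
- move=> u _; have := sqr_ge0 ((f u - g u) - (g u - h u)); nra.
Qed.

Definition sine_approximable w := forall eps, 0 < eps ->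
  exists2 s, sine_sum s & sqr_dist w s <= eps.

Lemma sine_approximable_lim w (w_ : nat -> R -> R) : bm L w ->
  (forall n, bm L (w_ n)) -> (forall n, sine_approximable (w_ n)) ->
  sqr_dist w (w_ n) @[n --> \oo] --> 0 -> sine_approximable w.
Proof.
move=> bw bw_ aw /cvgrPdist_le cw eps e0.
have /cw[n _ /(_ n (leqnn n))] : 0 < eps / 4 by rewrite divr_gt0.
rewrite sub0r normrN => wn.
have [s ss sn] := aw n (eps / 4) (divr_gt0 e0 (ltr0n _ 4)).
exists s => //; apply: le_trans (sqr_dist_le bw (bw_ n) (bm_sine_sum ss)) _.
by have := ler_norm (sqr_dist w (w_ n)); lra.
Qed.

Lemma bounded_cvg_sqr_dist w (w_ : nat -> R -> R) (M : R) : bm L w ->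
  (forall n, bm L (w_ n)) -> (forall n u, L u -> `|w_ n u| <= M) ->
  (forall u, L u -> w_ n u @[n --> \oo] --> w u) ->
  sqr_dist w (w_ n) @[n --> \oo] --> 0.
Proof.
move=> bw bw_ wM cw; have [mw [K wK]] := bw.
have -> : 0 = \int[mu]_(u in L) (cst 0 u) :> R.
  by rewrite Rintegral_cst ?mul0r//; exact: measurable_Lambda.
apply: (@bounded_cvg_Rintegral _ _ _ _ ((K + M) * (K + M))).
- exact: measurable_Lambda.
- by rewrite mu_Lambda ltry.
- by move=> n; have [] := bmM (bmB bw (bw_ n)) (bmB bw (bw_ n)).
- exact: measurable_cst.
- move=> n u Lu; rewrite normrM.
  have h : `|w u - w_ n u| <= K + M.
    by apply: le_trans (ler_normB _ _) _; rewrite lerD ?wK ?wM.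
  by rewrite ler_pM.
- move=> u Lu /=.
  have h : w u - w_ n u @[n --> \oo] --> 0.
    by rewrite -(subrr (w u)); apply: cvgB; [exact: cvg_cst|exact: cw].
  by rewrite -(mulr0 0); exact: cvgM.
Qed.

Lemma angle_in (u : R) : L u -> 0 < angle u < pi.
Proof.
rewrite /Lambda/= in_itv/= /angle => /andP[u1 u2].
have p0 := @pi_gt0 R.
by apply/andP; split; nra.
Qed.

Lemma sin_angle_gt0 (u : R) : L u -> 0 < sin (angle u).
Proof. by move=> /angle_in; exact: sin_gt0_pi. Qed.

Lemma bm_sin_angle : bm L (fun u => sin (angle u)).
Proof.
apply: bm_ext (bm_sin_mode 0) => u _.
by rewrite /sin_mode mul1r.
Qed.

(** In the variable y = (1 + cos (angle u))/2 the function [g] becomes [f], whose Bernstein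
    polynomials yield sine sums; they are uniformly bounded and converge pointwise, hence in L2. *)
Lemma sine_approximable_continuous g (M : R) : continuous g -> (forall u, `|g u| <= M) ->
  sine_approximable (fun u => sin (angle u) * g u).
Proof.
move=> cg gM.
(* The inverse substitution. [f] is bounded by [M] whatever [acos] returns outside [-1,1], and only
   its continuity for y in (0,1) is used, because [angle u] stays strictly between 0 and pi on the
   open interval. *)
pose f (y : R) := g (acos (2 * y - 1) * (2 / pi) - 1).
have x01 (u : R) : 0 <= (1 + cos (angle u)) / 2 <= 1.
  by have := @cos_geN1 R (angle u); have := @cos_le1 R (angle u); lra.
pose s n (u : R) := sin (angle u) *
  binomial_mean n (fun j => f (j%:R / n%:R)) ((1 + cos (angle u)) / 2).
have ss n : sine_sum (s n) by exact: sine_sum_binomial_mean.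
have fM y : `|f y| <= M by exact: gM.
apply: (@sine_approximable_lim _ s).
- by apply: bmM; [exact: bm_sin_angle | exact: continuous_bmL].
- by move=> n; exact: bm_sine_sum.
- move=> n eps e0; exists (s n) => //; rewrite /sqr_dist /inner.
  under eq_Rintegral do rewrite subrr mul0r.
  by rewrite Rintegral_cst ?mul0r ?ltW//; exact: measurable_Lambda.
- apply: (@bounded_cvg_sqr_dist _ _ M).
  + by apply: bmM; [exact: bm_sin_angle | exact: continuous_bmL].
  + by move=> n; exact: bm_sine_sum.
  + move=> n u _; rewrite normrM -[leRHS]mul1r ler_pM//.
      by rewrite ler_norml sin_geN1 sin_le1.
    exact: binomial_mean_norm_le.
  + move=> u Lu; apply: cvgM; first exact: cvg_cst.
    have /andP[a0 api] := angle_in Lu.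
    have cE : 2 * ((1 + cos (angle u)) / 2) - 1 = cos (angle u) by field.
    have pi0 : pi != 0 :> R by rewrite gt_eqF// pi_gt0.
    have fE : f ((1 + cos (angle u)) / 2) = g u.
      rewrite /f cE cosK; last by rewrite in_itv/= !ltW.
      by congr g; rewrite /angle; move: (pi : R) pi0 => p p0; field.
    rewrite -fE; apply: bernstein_cvg fM _ => //.
    have -> : f = g \o ((fun t => t * (2 / pi) - 1) \o (@acos R \o (fun y => 2 * y - 1)))
      by [].
    have c1 : {for (1 + cos (angle u)) / 2, continuous (fun y : R => 2 * y - 1)}.
      by apply: cvgB; [apply: cvgM; [exact: cvg_cst|exact: cvg_id]|exact: cvg_cst].
    apply: continuous_comp; last exact: cg.
    apply: continuous_comp; last first.
      by apply: cvgB; [apply: cvgM; [exact: cvg_id|exact: cvg_cst]|exact: cvg_cst].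
    apply: continuous_comp => //.
    apply: continuous_acos; rewrite cE.
    have aI : angle u \in `[0, pi] by rewrite in_itv/= !ltW.
    apply/andP; split.
      by rewrite -cospi ltr_cos// in_itv/= lexx pi_ge0.
    by rewrite -cos0 ltr_cos// in_itv/= lexx pi_ge0.
Qed.

Lemma continuous_clamp (M : R) g : continuous g ->
  continuous (fun u => Num.max (- M) (Num.min M (g u))).
Proof.
move=> cg u; apply: (@continuous_max _ _ (cst (- M)) (fun u => Num.min M (g u))).
  exact: cst_continuous.
apply: (@continuous_min _ _ (cst M) g); last exact: cg.
exact: cst_continuous.
Qed.

(** Continuous functions approximate [h] in L1. Clamping them to [-M,M] does not increase the
    distance to [h], since |h| <= M, and makes the squared difference at most 2M times the L1
    integrand. *)
Lemma sine_approximable_sinM h : bm L h ->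
  sine_approximable (fun u => sin (angle u) * h u).
Proof.
move=> bh; have [mh [M hM]] := bh.
have Lfin : (mu L < +oo)%E by rewrite mu_Lambda ltry.
have [g_ [cg ig cvg]] := @approximation_continuous_integrable R L h
  measurable_Lambda Lfin (bmL_integrable bh).
pose k n u := Num.max (- M) (Num.min M (g_ n u)).
have M0 : 0 <= M.
  by apply: le_trans (hM 0 _) => //; rewrite /Lambda/= in_itv/=; apply/andP; split; lra.
have kM n u : `|k n u| <= M.
  rewrite /k ler_norml le_max lexx /= ge_max ge_min lexx /= andbT.
  by rewrite -subr_ge0 opprK addr_ge0.
have ck n : continuous (k n) by exact: continuous_clamp.
have bsk n : bm L (fun u => sin (angle u) * k n u).
  by apply: bmM; [exact: bm_sin_angle | exact: continuous_bmL].
have bsh : bm L (fun u => sin (angle u) * h u) by apply: bmM => //; exact: bm_sin_angle.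
apply: (@sine_approximable_lim _ (fun n u => sin (angle u) * k n u)) => //.
  by move=> n; exact: sine_approximable_continuous.
have cvg' : 2 * M * \int[mu]_(z in L) `|h z - g_ n z| @[n --> \oo] --> 0.
  rewrite -(mulr0 (2 * M)); apply: cvgM; first exact: cvg_cst.
  by have /fine_cvgP[_] := cvg.
apply: (@squeeze_cvgr _ _ _ _ (cst 0) _ _ _ _ _ cvg'); last exact: cvg_cst.
apply: nearW => n; rewrite inner_ge0 /=.
have ihg : mu.-integrable L (EFin \o (fun z => h z - g_ n z)).
  rewrite /comp; under eq_fun do rewrite EFinB.
  by apply: integrableB; [exact: measurable_Lambda|exact: bmL_integrable|exact: ig].
rewrite -RintegralZl; first last.
- exact: integrable_norm.
- exact: measurable_Lambda.
apply: le_Rintegral.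
- exact: measurable_Lambda.
- by apply: bmL_integrable; apply: bmM; exact: bmB.
- rewrite /comp; under eq_fun do rewrite EFinM.
  by apply: integrableZl; [exact: measurable_Lambda|exact: integrable_norm].
move=> u Lu; have /ler_normlP[h1 h2] := hM u Lu.
have sn : sin (angle u) ^+ 2 <= 1.
  by rewrite -(cos2Dsin2 (angle u)) lerDr sqr_ge0.
have d1 : `|h u - k n u| <= `|h u - g_ n u|.
  rewrite /k; case: (leP M (g_ n u)) => [Mg|gM].
    rewrite max_r; last by lra.
    by rewrite !ler0_norm; lra.
  case: (leP (- M) (g_ n u)) => [//|gM'].
  by rewrite !ger0_norm; lra.
have d2 : `|h u - k n u| <= 2 * M.
  by apply: le_trans (ler_normB _ _) _; have := kM n u; have := hM u Lu; lra.
have -> : (sin (angle u) * h u - sin (angle u) * k n u) *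
   (sin (angle u) * h u - sin (angle u) * k n u) =
   sin (angle u) ^+ 2 * `|h u - k n u| ^+ 2.
  by rewrite real_normK ?num_real//; ring.
have := normr_ge0 (h u - k n u); have := sqr_ge0 (sin (angle u)).
by nra.
Qed.

(** The factor [sin (angle u)] has to be divided out although it vanishes at the ends. Dividing by
    its maximum with 1/(n+1) keeps the quotient bounded; the ratio of the sine to this maximum is at
    most 1 and equals 1 at each interior point for large n. *)
Lemma bm_sine_approximable w : bm L w -> sine_approximable w.
Proof.
move=> bw; have [mw [M wM]] := bw.
pose m n (u : R) := Num.max (sin (angle u)) n.+1%:R^-1.
have m0 n u : 0 < m n u by rewrite /m lt_max invr_gt0 ltr0n orbT.
have cm n : continuous (m n).
  move=> u; apply: (@continuous_max _ _ (fun u => sin (angle u)) (cst n.+1%:R^-1)).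
    have := @continuous_sin_mode R 0 u; congr continuous_at.
    by apply/funext => v; rewrite /sin_mode mul1r.
  exact: cst_continuous.
have bq n : bm L (fun u => w u * (m n u)^-1).
  apply: bmM => //; apply: continuous_bmL => u.
  by apply: cvgV; [rewrite gt_eqF|exact: cm].
have bs n : bm L (fun u => sin (angle u) * (w u * (m n u)^-1)).
  by apply: bmM => //; exact: bm_sin_angle.
apply: (@sine_approximable_lim _ (fun n u => sin (angle u) * (w u * (m n u)^-1))) => //.
  by move=> n; exact: sine_approximable_sinM.
apply: (@bounded_cvg_sqr_dist _ _ M) => //.
  move=> n u Lu; rewrite mulrCA normrM -[leRHS]mulr1 ler_pM ?wM//.
  have s0 := sin_angle_gt0 Lu.
  rewrite ger0_norm; last by rewrite divr_ge0// ltW.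
  by rewrite ler_pdivrMr// mul1r /m le_max lexx.
move=> u Lu; have s0 := sin_angle_gt0 Lu.
apply: cvg_near_cst; near=> n.
have -> : m n u = sin (angle u).
  apply/max_idPl; rewrite -[leRHS]invrK lef_pV2 ?posrE ?invr_gt0//.
  by near: n; apply: filterS (nbhs_infty_ger (sin (angle u))^-1) => n; move/le_trans;
    apply; rewrite ler_nat.
by field; rewrite gt_eqF.
Unshelve. all: by end_near. Qed.

(** Once N exceeds the number of modes of an approximating sine sum, the projection on the first N
    modes is at least as close to [w], and its squared error is the gap in Bessel's inequality. *)
Lemma parseval w : bm L w ->
  \sum_(k < N) inner w (sin_mode k) ^+ 2 @[N --> \oo] --> inner w w.
Proof.
move=> bw; apply/cvgrPdist_le => eps e0.
have [s [N0 [c sE]] ws] := bm_sine_approximable bw e0.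
exists N0 => // N /= N0N.
have be k : bm L (@sin_mode R k) by exact: bm_sin_mode.
have bes := bessel be (@sin_mode_orthonormal R) N bw.
rewrite ger0_norm ?subr_ge0//; apply: le_trans ws.
have {}sE : s = fun u => \sum_(k < N) (if (k < N0)%N then c k else 0) * sin_mode k u.
  by apply/funext => u; rewrite sE (sine_sum_widen _ _ N0N).
rewrite /sqr_dist sE.
rewrite (sqr_dist_orthonormal be (@sin_mode_orthonormal R) (fun k => if (k < N0)%N then c
  k else 0) N bw).
by rewrite lerDl sumr_ge0// => k _; exact: sqr_ge0.
Qed.

End SineCompleteness.

(** * The nonlocal drift *)

Section Kernel.
Context {R : realType}.
Local Notation mu := (@lebesgue_measure R).
Local Notation L := (@Lambda R).
Implicit Types (f g m : R -> R) (K : R -> R -> R).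
Local Notation bm := bounded_measurable.

Lemma continuous_slice (F : R -> R -> R) (u : R) :
  continuous (fun p : R * R => F p.1 p.2) -> continuous (F u).
Proof.
move=> cF v; apply: (@continuous2_cvg _ _ _ _ _ _ (fun=> u) id F).
- exact: (cF (u, v)).
- exact: cvg_cst.
- exact: cvg_id.
Qed.

Lemma continuous_slice1 (F : R -> R -> R) (v : R) :
  continuous (fun p : R * R => F p.1 p.2) -> continuous (F ^~ v).
Proof.
move=> cF u; apply: (@continuous2_cvg _ _ _ _ _ _ id (fun=> v) F).
- exact: (cF (u, v)).
- exact: cvg_id.
- exact: cvg_cst.
Qed.

(** Translation invariance passes to the derivative, so [K] is a continuous function of one variable
    composed with v - u; this gives measurability for the product sigma-algebra. *)
Lemma measurable_translation_kernel (J : R -> R -> R) (K : R -> R -> R) : 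
  (forall u v, J u v = J 0 (v - u)) ->
  continuous (fun p : R * R => K p.1 p.2) ->
  (forall u v : R, is_derive u 1 (fun x => J x v) (K u v)) ->
  measurable_fun setT (fun p : R * R => K p.1 p.2).
Proof.
move=> hJ cK dK.
have KE u v : K u v = K 0 (v - u).
  have [_ <-] := dK u v.
  have -> : (fun x => J x v) = (fun x => J (x - u) (v - u)).
    by apply/funext => x; rewrite hJ [RHS]hJ; congr (J 0 _); ring.
  have h1 := dK (u - u) (v - u).
  have h2 : is_derive u 1 (fun x : R => x - u) (1 - 0) by exact: is_deriveB.
  have [_ ->] := @is_derive1_comp _ (fun x => J x (v - u)) (fun x => x - u) u _ _ h1 h2.
  by rewrite subrr subr0 mulr1.
have -> : (fun p : R * R => K p.1 p.2) = (K 0) \o (fun p : R * R => p.2 - p.1).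
  by apply/funext => p /=; rewrite KE.
apply: measurableT_comp.
  by apply: continuous_measurable_fun; exact: continuous_slice.
by apply: measurable_funB; [exact: measurable_snd|exact: measurable_fst].
Qed.

(** The reflections in [Jneum] act on the second variable only, so differentiation in the first one
    commutes with them. *)
Lemma Jneum_gradient (J : R -> R -> R) : smooth2 J ->
  (forall u v, J u v = J 0 (v - u)) ->
  exists K : R -> R -> R,
  [/\ continuous (fun p : R * R => K p.1 p.2),
      measurable_fun setT (fun p : R * R => K p.1 p.2),
      continuous (fun p : R * R => Jneum J p.1 p.2) &
      forall u v : R, is_derive u 1 (fun x => Jneum J x v) (K u v)].
Proof.
move=> [D [DJ Dd]] tJ.
have [c0 d0 _] := Dd 0%N 0%N.
have [c1 _ _] := Dd 1%N 0%N.
have JE : J = D 0%N 0%N by apply/funext => u; apply/funext => v; rewrite DJ.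
pose K u v := D 1%N 0%N u v + D 1%N 0%N u (2 - v) + D 1%N 0%N u (- 2 - v).
have refl_cont (f : R -> R -> R) (a : R) : continuous (fun p : R * R => f p.1 p.2) ->
    continuous (fun p : R * R => f p.1 (a - p.2)).
  move=> cf p; apply: (@continuous2_cvg _ _ _ _ _ _ fst (fun p : R * R => a - p.2) f).
  - exact: (cf (p.1, a - p.2)).
  - exact: cvg_fst.
  - by apply: cvgB; [exact: cvg_cst|exact: cvg_snd].
have sum_cont (f : R -> R -> R) : continuous (fun p : R * R => f p.1 p.2) ->
    continuous (fun p : R * R => f p.1 p.2 + f p.1 (2 - p.2) + f p.1 (- 2 - p.2)).
  move=> cf p; apply: cvgD; last exact: (refl_cont f).
  by apply: cvgD; [exact: cf | exact: (refl_cont f)].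
have mD : measurable_fun setT (fun p : R * R => D 1%N 0%N p.1 p.2).
  by apply: (measurable_translation_kernel tJ) => //; rewrite JE.
have mDr (a : R) : measurable_fun setT (fun p : R * R => D 1%N 0%N p.1 (a - p.2)).
  have mr : measurable_fun setT (fun p : R * R => a - p.2).
    by apply: measurable_funB; [exact: measurable_cst|exact: measurable_snd].
  exact: (measurableT_comp mD (measurable_fun_pair measurable_fst mr)).
exists K; split; [exact: sum_cont | | by rewrite JE; exact: sum_cont |].
  by apply: measurable_funD => //; exact: measurable_funD.
move=> u v; rewrite JE /Jneum /K.
have h1 := d0 u v; have h2 := d0 u (2 - v); have h3 := d0 u (- 2 - v).
exact: is_deriveD.
Qed.

(** The square exceeds [-1,1]^2 so that the points -1 and 1 are interior wherever continuity or
    two-sided derivatives are needed. *)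
Lemma continuous_bounded_square (K : R -> R -> R) :
  continuous (fun p : R * R => K p.1 p.2) ->
  exists2 B : R, 0 <= B & forall u v : R, -2 <= u <= 2 -> -2 <= v <= 2 -> `|K u v| <= B.
Proof.
move=> cK.
have cQ : compact ((`[-2, 2] : set R) `*` (`[-2, 2] : set R)).
  by apply: compact_setX; exact: segment_compact.
have cK' := continuous_subspaceT cK.
have /compact_bounded[M [_ mrt]] :=
  @continuous_compact _ _ (fun p : R * R => K p.1 p.2) _ (cK' _) cQ.
exists (`|M| + 1); first by rewrite addr_ge0.
move=> u v hu hv; apply: (mrt (`|M| + 1)); first by rewrite (le_lt_trans (ler_norm M))//
  ltrDl.
by exists (u, v) => //=; rewrite !in_itv/=.
Qed.

(** With [K] the derivative of [Jneum J] in its first variable this is the gradient of the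
    convolution, as [derive1_Jstar] proves; unlike that gradient it is controlled up to and beyond
    the boundary. *)
Definition nonlocal_grad K m (u : R) : R := \int[mu]_(v in L) (K u v * m v).

Definition flux K m (u : R) : R := sigma (m u) * nonlocal_grad K m u.

Section Estimates.
Variables (K : R -> R -> R) (B : R).
Hypothesis cK : continuous (fun p : R * R => K p.1 p.2).
Hypothesis B0 : 0 <= B.
Hypothesis KB : forall u v : R, -2 <= u <= 2 -> -2 <= v <= 2 -> `|K u v| <= B.

Lemma Lambda_in2 (u : R) : L u -> -2 <= u <= 2.
Proof. by rewrite /Lambda/= in_itv/=; lra. Qed.

Lemma bm_slice (F : R -> R -> R) (u : R) m :
  continuous (fun p : R * R => F p.1 p.2) -> bm L m -> bm L (fun v => F u v * m v).
Proof. by move=> cF bm_; apply: bmM => //; apply/continuous_bmL/continuous_slice. Qed.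

Lemma normr_RintegralL_le f g : bm L f -> bm L g ->
  (forall u, L u -> `|f u| <= g u) ->
  `|\int[mu]_(u in L) f u| <= \int[mu]_(u in L) g u.
Proof.
move=> bf bg fg; have mL := @measurable_Lambda R.
apply: (le_trans (@le_normr_Rintegral _ (measurableTypeR R) R mu L f mL (bmL_integrable
  bf))).
apply: le_Rintegral => //; last exact: bmL_integrable.
exact: (integrable_norm (bmL_integrable bf)).
Qed.

Lemma bm_norm f : bm L f -> bm L (fun u => `|f u|).
Proof.
move=> [mf [M fM]]; split; first exact: measurableT_comp.
by exists M => u Lu; rewrite normr_id fM.
Qed.

Lemma nonlocal_grad_le m (u : R) : bm L m -> -2 <= u <= 2 ->
  `|nonlocal_grad K m u| <= B * \int[mu]_(v in L) `|m v|.
Proof.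
move=> bm_ hu; rewrite -RintegralZl; first last.
- exact/bmL_integrable/bm_norm.
- exact: measurable_Lambda.
apply: normr_RintegralL_le; first exact: bm_slice.
  by apply: bmZ; exact: bm_norm.
by move=> v Lv; rewrite normrM ler_wpM2r// KB//; exact: Lambda_in2.
Qed.

Lemma nonlocal_gradB m m' (u : R) : bm L m -> bm L m' ->
  nonlocal_grad K m u - nonlocal_grad K m' u =
  nonlocal_grad K (fun v => m v - m' v) u.
Proof.
move=> b1 b2; rewrite -RintegralB; first last.
- by apply: bmL_integrable; exact: bm_slice.
- by apply: bmL_integrable; exact: bm_slice.
- exact: measurable_Lambda.
by apply: eq_Rintegral => v _; rewrite mulrBr.
Qed.

Lemma continuous_nonlocal_grad m (u : R) : bm L m -> -2 < u < 2 ->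
  {for u, continuous (nonlocal_grad K m)}.
Proof.
move=> bm_ hu; have [mm [M mM]] := bm_.
apply: (@continuity_under_integral R _ (measurableTypeR R) mu (fun u v => K u v * m v) L
  measurable_Lambda (-2) 2
  _ _ (cst (B * M))).
- by move=> x _; apply: bmL_integrable; exact: bm_slice.
- apply: aeW => v Lv x _; apply: cvgM; last exact: cvg_cst.
  exact: (continuous_slice1 cK).
- exact: (bmL_integrable (bm_cst _ _)).
- move=> x xI; apply: aeW => v Lv; rewrite normrM ler_pM ?mM//.
  apply: KB; last exact: Lambda_in2.
  by move: xI; rewrite /= in_itv/=; lra.
- by rewrite inE/= in_itv/=.
Qed.

Lemma bm_nonlocal_grad m : bm L m -> bm L (nonlocal_grad K m).
Proof.
move=> bm_; apply: within_continuous_bm.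
apply: (continuous_in_subspaceT) => u; rewrite inE /Lambda_bar/= in_itv/= => hu.
by apply: continuous_nonlocal_grad => //; lra.
Qed.

Lemma derive1_Jstar (J : R -> R -> R) m (u : R) :
  continuous (fun p : R * R => Jneum J p.1 p.2) ->
  (forall u v : R, is_derive u 1 (fun x => Jneum J x v) (K u v)) ->
  bm L m -> L u -> derive1 (Jstar J m) u = nonlocal_grad K m u.
Proof.
move=> cJ dJ bm_ Lu; have [mm [M mM]] := bm_.
have dJm (x v : R) : is_derive x 1 (fun x => Jneum J x v * m v) (K x v * m v).
  have h := dJ x v; apply: is_derive_eq.
  by rewrite /GRing.scale /= mulr0 add0r mulrC.
rewrite (@differentiation_under_integral R _ (measurableTypeR R) mu (fun u v => Jneum J u
  v * m v) L measurable_Lambda u (-1) 1 Lu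
  _ _ (cst (B * `|M|))).
- apply: eq_Rintegral => v _; rewrite partial1of2E.
  by have [_ ->] := dJm u v.
- by move=> x _; apply: bmL_integrable; exact: bm_slice.
- by move=> x v _ _; have [] := dJm x v.
- by move=> v; rewrite mulr_ge0.
- exact: (bmL_integrable (bm_cst _ _)).
- move=> x v xI Lv; rewrite partial1of2E.
  have [_ ->] := dJm x v.
  rewrite normrM ler_pM//.
    by apply: KB; exact: Lambda_in2.
  exact: le_trans (mM _ Lv) (ler_norm _).
Qed.

End Estimates.

End Kernel.

(** * Truncation and Lipschitz bounds for the flux *)

Section Flux.
Context {R : realType}.
Local Notation mu := (@lebesgue_measure R).
Local Notation L := (@Lambda R).
Implicit Types (f g m a b w : R -> R).
Local Notation bm := bounded_measurable.

(** Serves twice: it selects a representative with values in [0,1] everywhere from an almost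
    everywhere bound, and it truncates the nonlinearity in the fixed-point equation. *)
Definition clamp01 (x : R) : R := Num.max 0 (Num.min 1 x).

Lemma clamp01_in x : 0 <= clamp01 x <= 1.
Proof. by rewrite /clamp01 le_max lexx /= ge_max ler01 ge_min lexx. Qed.

Lemma clamp01_id x : 0 <= x <= 1 -> clamp01 x = x.
Proof. by move=> /andP[x0 x1]; rewrite /clamp01 min_r// max_r. Qed.

Lemma clamp01_le0 x : x <= 0 -> clamp01 x = 0.
Proof. by move=> x0; rewrite /clamp01 min_r ?max_l//; lra. Qed.

Lemma clamp01_ge1 x : 1 <= x -> clamp01 x = 1.
Proof. by move=> x0; rewrite /clamp01 min_l ?max_r//; lra. Qed.

Lemma clamp01_lip x y : `|clamp01 x - clamp01 y| <= `|x - y|.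
Proof.
wlog xy : x y / x <= y.
  move=> H; have [/H//|/ltW/H] := leP x y.
  by rewrite distrC [leRHS]distrC.
rewrite [leRHS]distrC [leLHS]distrC (@ger0_norm _ (y - x)) ?subr_ge0//.
rewrite ler_norml; have [x0|x0] := leP x 0; have [y0|y0] := leP y 0;
  have [x1|x1] := leP 1 x; have [y1|y1] := leP 1 y;
  rewrite ?(clamp01_le0 x0) ?(clamp01_le0 y0) ?(clamp01_ge1 x1) ?(clamp01_ge1 y1);
  rewrite ?(@clamp01_id x) ?(@clamp01_id y); try (apply/andP; split); lra.
Qed.

Lemma continuous_clamp01 : continuous clamp01.
Proof.
move=> x; rewrite (_ : clamp01 = fun u => Num.max 0 (Num.min 1 u))//.
apply: (@continuous_max R R (cst 0) (fun u => Num.min 1 u)).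
  exact: cst_continuous.
apply: (@continuous_min R R (cst 1) id); last exact: cvg_id.
exact: cst_continuous.
Qed.

Lemma measurable_clamp01 : measurable_fun setT clamp01.
Proof. by apply: continuous_measurable_fun; exact: continuous_clamp01. Qed.

Definition density a := measurable_fun L a /\ forall u, L u -> 0 <= a u <= 1.

Lemma density_clamp01 a : measurable_fun L a -> density (clamp01 \o a).
Proof.
move=> ma; split; first exact: (measurableT_comp measurable_clamp01 ma).
by move=> u _; exact: clamp01_in.
Qed.

Lemma density_bm a : density a -> bm L a.
Proof.
move=> [ma a01]; split => //; exists 1 => u Lu.
by rewrite ger0_norm; have /andP[] := a01 u Lu.
Qed.

Lemma sigma_lip (x y : R) : 0 <= x <= 1 -> 0 <= y <= 1 ->
  `|sigma x - sigma y| <= 2 * `|x - y|.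
Proof.
move=> hx hy; have -> : sigma x - sigma y = 2 * (1 - x - y) * (x - y).
  by rewrite /sigma; ring.
rewrite normrM ler_wpM2r// normrM ger0_norm// ler_piMr//.
by rewrite ler_norml; lra.
Qed.

Lemma sigma_bound (x : R) : 0 <= x <= 1 -> `|sigma x| <= 2^-1.
Proof.
move=> hx; rewrite ger0_norm /sigma; last by nra.
have := sqr_ge0 (x - 2^-1); nra.
Qed.

Lemma bm_sigma a : bm L a -> bm L (fun u => sigma (a u)).
Proof.
move=> ba; rewrite /sigma; apply: bmM; first exact: bmZ.
by apply: bmB => //; exact: bm_cst.
Qed.

(** Cauchy-Schwarz on an interval of length 2, obtained from the nonnegative variance of |w| about
    its mean m/2. *)
Lemma sqr_L1_le w : bm L w -> (\int[mu]_(v in L) `|w v|) ^+ 2 <= 2 * inner w w.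
Proof.
move=> bw; set m := \int[mu]_(v in L) _.
have bn := bm_norm bw.
have := inner_ge0 (fun u => `|w u| - m / 2).
have mL := @measurable_Lambda R.
have bc := bm_cst L (m / 2).
rewrite innerBr//; last exact: bmB.
rewrite !innerBl//.
have -> : inner (fun u => `|w u|) (fun u => `|w u|) = inner w w.
  by apply: eq_Rintegral => u _; rewrite -!expr2 real_normK ?num_real.
have -> : inner (fun u => `|w u|) (cst (m / 2)) = m * (m / 2).
  by rewrite /inner RintegralZr//; exact: bmL_integrable.
have -> : inner (cst (m / 2)) (fun u => `|w u|) = m * (m / 2).
  by rewrite /inner RintegralZl//; [rewrite mulrC|exact: bmL_integrable].
have -> : inner (cst (m / 2)) (cst (m / 2)) = m / 2 * (m / 2) * 2.
  by rewrite /inner /= Rintegral_cst// -[X in fine X]/(mu L) mu_Lambda.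
nra.
Qed.

Lemma L1_bound w (s : R) : bm L w -> (forall u, L u -> `|w u| <= s) ->
  \int[mu]_(v in L) `|w v| <= 2 * s.
Proof.
move=> bw ws; have mL := @measurable_Lambda R.
have -> : 2 * s = \int[mu]_(v in L) (cst s v).
  by rewrite Rintegral_cst// -[X in fine X]/(mu L) mu_Lambda mulrC.
apply: le_Rintegral => //; [exact/bmL_integrable/bm_norm|].
exact/bmL_integrable/bm_cst.
Qed.

Section Estimates.
Variables (K : R -> R -> R) (B : R).
Hypothesis cK : continuous (fun p : R * R => K p.1 p.2).
Hypothesis B0 : 0 <= B.
Hypothesis KB : forall u v : R, -2 <= u <= 2 -> -2 <= v <= 2 -> `|K u v| <= B.

Lemma bm_flux a : density a -> bm L (flux K a).
Proof.
move=> /density_bm ba; apply: bmM; first exact: bm_sigma.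
exact: (bm_nonlocal_grad cK KB).
Qed.

(** The product rule for differences: [sigma] is 2-Lipschitz and the gradient of a density is at
    most 2B, whence 4B; [sigma] is at most 1/2, whence B/2. The point [u] may lie outside the open
    interval because the contraction estimate also needs -1 and 1. *)
Lemma flux_diff a b (u : R) : density a -> density b -> -2 <= u <= 2 ->
  0 <= a u <= 1 -> 0 <= b u <= 1 ->
  `|flux K a u - flux K b u| <=
    4 * B * `|a u - b u| + B / 2 * \int[mu]_(v in L) `|a v - b v|.
Proof.
move=> da db hu au bu; have [ba bb] := (density_bm da, density_bm db).
have -> : flux K a u - flux K b u =
    (sigma (a u) - sigma (b u)) * nonlocal_grad K a u +
    sigma (b u) * (nonlocal_grad K a u - nonlocal_grad K b u).
  by rewrite /flux; ring.
apply: le_trans (ler_normD _ _) _; rewrite lerD// normrM.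
- rewrite (_ : 4 * B * _ = 2 * `|a u - b u| * (B * (2 * 1))); last by ring.
  rewrite ler_pM ?sigma_lip//.
  apply: le_trans (nonlocal_grad_le cK KB ba hu) _.
  rewrite ler_wpM2l// L1_bound// => v Lv.
  by have /andP[a0 a1] := da.2 v Lv; rewrite ger0_norm.
- rewrite nonlocal_gradB// (mulrC B) -mulrA ler_pM ?sigma_bound//.
  by apply: (nonlocal_grad_le cK KB) => //; exact: bmB.
Qed.

(** Squaring [flux_diff] with (p + q)^2 <= 2p^2 + 2q^2 gives 32 B^2 for the local term. The nonlocal
    one is B^2 m^2/2 on an interval of length 2, with m^2 at most twice the squared distance:
    another 2 B^2. *)
Lemma sqr_dist_flux a b : density a -> density b ->
  sqr_dist (flux K a) (flux K b) <= 34 * B ^+ 2 * sqr_dist a b.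
Proof.
move=> da db; have [ba bb] := (density_bm da, density_bm db).
have bw := bmB ba bb.
have bn := bm_norm bw.
have bF := bmB (bm_flux da) (bm_flux db).
pose m := \int[mu]_(v in L) `|a v - b v|.
have m2 : m ^+ 2 <= 2 * sqr_dist a b by exact: sqr_L1_le.
have mL := @measurable_Lambda R.
apply: (@le_trans _ _ (\int[mu]_(u in L)
    (32 * B ^+ 2 * ((a u - b u) * (a u - b u)) + cst (B ^+ 2 / 2 * m ^+ 2) u))).
  apply: le_Rintegral => //.
  - by apply: bmL_integrable; exact: bmM.
  - by apply: bmL_integrable; apply: bmD; [apply: bmZ; exact: bmM|exact: bm_cst].
  - move=> u Lu /=.
    have := flux_diff da db (Lambda_in2 Lu) (da.2 u Lu) (db.2 u Lu).
    rewrite -/m -!expr2 -(real_normK (num_real (flux K a u - _))).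
    rewrite -(real_normK (num_real (a u - _))).
    set x := `|flux K a u - _|; set y := `|a u - b u| => xy.
    have x0 : 0 <= x by exact: normr_ge0.
    apply: (@le_trans _ _ ((4 * B * y + B / 2 * m) ^+ 2)).
      by rewrite lerXn2r ?nnegrE//; exact: le_trans xy.
    rewrite [leRHS](_ : _ = (4 * B * y + B / 2 * m) ^+ 2 + (4 * B * y - B / 2 * m) ^+ 2);
      last by field.
    by rewrite lerDl sqr_ge0.
rewrite RintegralD//; first last.
- exact/bmL_integrable/bm_cst.
- by apply: bmL_integrable; apply: bmZ; exact: bmM.
rewrite RintegralZl//; last by apply: bmL_integrable; exact: bmM.
rewrite Rintegral_cst// -[X in fine X]/(mu L) mu_Lambda /=.
rewrite -[X in _ * X + _]/(sqr_dist a b).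
have := ler_wpM2l (sqr_ge0 B) m2; lra.
Qed.

End Estimates.

End Flux.

(** * Weak formulations on the modes and stationary uniqueness *)

Section WeakForms.
Context {R : realType}.
Local Notation mu := (@lebesgue_measure R).
Local Notation L := (@Lambda R).
Implicit Types (f g m a b w : R -> R).
Local Notation bm := bounded_measurable.

Lemma sin_mode_C2_0 k : C2_0 (@sin_mode R k) (fun u => freq k * cos_mode k u)
  (fun u => freq k * - (freq k * sin_mode k u)).
Proof.
have cZ (c : R) (f : R -> R) : continuous f -> continuous (fun u => c * f u).
  by move=> cf u; apply: cvgM; [exact: cvg_cst|exact: cf].
split; split.
- by apply: continuous_subspaceT; exact: continuous_sin_mode.
- by apply: continuous_subspaceT; apply: cZ; exact: continuous_cos_mode.
- apply: continuous_subspaceT; apply: (cZ) => u; apply: cvgN.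
  by apply: cZ; exact: continuous_sin_mode.
- by move=> u _; exact: is_derive_sin_mode.
- move=> u _; have h := is_derive_cos_mode k u; apply: is_derive_eq.
  by rewrite /GRing.scale /= ?mulr0 ?mul0r ?addr0 ?add0r.
- exact: sin_mode_boundary.
Qed.

(* Small enough both for the L2 estimate [sqr_dist_scaled_flux] and for the
   sup-norm contraction behind the existence proof. *)
Definition small_coupling (B beta : R) := 0 <= beta /\ beta * (20 * (B + 1)) <= 1.

Section Kernel.
Variables (J K : R -> R -> R) (B : R).
Hypothesis cK : continuous (fun p : R * R => K p.1 p.2).
Hypothesis B0 : 0 <= B.
Hypothesis KB : forall u v : R, -2 <= u <= 2 -> -2 <= v <= 2 -> `|K u v| <= B.
Hypothesis cJ : continuous (fun p : R * R => Jneum J p.1 p.2).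
Hypothesis dJ : forall u v : R, is_derive u 1 (fun x => Jneum J x v) (K u v).

Lemma clamp01_ae m : {ae mu, forall u, L u -> 0 <= m u <= 1} ->
  m = clamp01 \o m %[ae mu in L].
Proof. by apply: filterS => u h Lu /=; rewrite clamp01_id// h. Qed.

(** [Jstar J m] sees only the almost everywhere class of [m], so truncation leaves it equal at every
    point and its derivative may be computed from the truncated density. *)
Lemma inner_drift m (G1 : R -> R) : measurable_fun L m ->
  {ae mu, forall u, L u -> 0 <= m u <= 1} ->
  inner (fun u => sigma (m u)) (fun u => G1 u * derive1 (Jstar J m) u) =
  inner (flux K (clamp01 \o m)) G1.
Proof.
move=> mm m01; have mE := clamp01_ae m01.
have bc := density_bm (density_clamp01 mm).
have -> : Jstar J m = Jstar J (clamp01 \o m).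
  apply/funext => u; apply: ae_eq_Rintegral.
  by apply: filterS mE => v h Lv; rewrite h.
apply: ae_eq_Rintegral; apply: filterS mE => u h Lu.
rewrite (derive1_Jstar B0 KB cJ dJ bc Lu) /flux /=.
by have /= <- := h Lu; ring.
Qed.

Section Stationary.
Variables (beta rhom rhop : R).

Definition stationary_modes a := forall k,
  freq k ^+ 2 * inner a (sin_mode k) + rhop * (freq k * cos_mode k 1)
  - rhom * (freq k * cos_mode k (-1))
  - beta / 2 * (freq k * inner (flux K a) (cos_mode k)) = 0.

Lemma stationary_solution_modes rho : stationary_solution J beta rhom rhop rho ->
  [/\ measurable_fun L rho, rho = clamp01 \o rho %[ae mu in L] &
      stationary_modes (clamp01 \o rho)].
Proof.
move=> [[g [[mrho _] _ _]] rho01 weak]; split=> //; first exact: clamp01_ae.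
have da := density_clamp01 mrho; have ba := density_bm da.
move=> k; rewrite -[RHS](weak _ _ _ (sin_mode_C2_0 k)) inner_drift//.
congr (_ + _ - _ - _ * _).
- rewrite (ae_eq_inner (clamp01_ae rho01) (ae_eq_refl _ _ _)).
  rewrite innerZr//; last by apply: bmN; apply: bmZ; exact: bm_sin_mode.
  rewrite innerNr//; last by apply: bmZ; exact: bm_sin_mode.
  rewrite innerZr//; last exact: bm_sin_mode.
  by ring.
- by rewrite innerZr//; [exact: (bm_flux cK KB da)|exact: bm_cos_mode].
Qed.

(** From beta B <= 1/20 the factor is at most 34/1600, far below the 1/2 that absorption
    requires. *)
Lemma sqr_dist_scaled_flux a b : small_coupling B beta -> density a -> density b ->
  (beta / 2) ^+ 2 * sqr_dist (flux K a) (flux K b) <= 2^-1 * sqr_dist a b.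
Proof.
move=> [b0 b1] da db; have h := sqr_dist_flux cK B0 KB da db.
have S0 : 0 <= sqr_dist a b by exact: inner_ge0.
have bB : beta * B <= 20^-1.
  rewrite -[leRHS]mul1r ler_pdivlMr//; apply: le_trans b1.
  by rewrite -mulrA ler_wpM2l//; lra.
have bB0 : 0 <= beta * B by exact: mulr_ge0.
have : (beta * B) ^+ 2 <= 20^-1 ^+ 2 by rewrite lerXn2r ?nnegrE.
have := ler_wpM2l (sqr_ge0 (beta / 2)) h.
have -> : (beta / 2) ^+ 2 * (34 * B ^+ 2 * sqr_dist a b) =
  (beta * B) ^+ 2 * (34 / 4 * sqr_dist a b) by field.
move=> h1 h2; apply: le_trans h1 _.
apply: le_trans (ler_wpM2r _ h2) _; first by apply: mulr_ge0.
by lra.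
Qed.

Lemma stationary_modes_unique a b : small_coupling B beta -> density a -> density b ->
  stationary_modes a -> stationary_modes b -> a = b %[ae mu in L].
Proof.
move=> sb da db sa sb'.
have [ba bb] := (density_bm da, density_bm db).
have [bfa bfb] := (bm_flux cK KB da, bm_flux cK KB db).
pose w u := a u - b u; pose F u := flux K a u - flux K b u.
have bw : bm L w by exact: bmB.
have bF : bm L F by exact: bmB.
have key k : inner w (sin_mode k) ^+ 2 <= (beta / 2) ^+ 2 * inner F (cos_mode k) ^+ 2.
  have E : freq k * inner w (sin_mode k) = beta / 2 * inner F (cos_mode k).
    rewrite /w /F !innerBl//; [|exact: bm_cos_mode|exact: bm_sin_mode].
    have f0 : freq k != 0 :> R by rewrite gt_eqF// (lt_le_trans _ (freq_ge1 k)).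
    (* After multiplication by [freq k] the claim is the difference of the two mode identities, in
       which the boundary terms cancel. *)
    apply: (mulfI f0); have := sa k; have := sb' k.
    move: (inner a _) (inner b _) (inner (flux K a) _) (inner (flux K b) _).
    move: (freq k) (cos_mode k 1) (cos_mode k (-1)) (beta / 2).
    by move=> f c1 c2 b' A A' P P'; lra.
  rewrite -exprMn -E exprMn ler_peMl ?sqr_ge0// -[1](expr1n _ 2).
  by rewrite lerXn2r ?nnegrE ?freq_ge1// (le_trans _ (freq_ge1 k)).
(* Parseval for the sines on the left, Bessel for the cosines on the right. *)
have w0 : inner w w <= 2^-1 * inner w w.
  apply: le_trans (sqr_dist_scaled_flux sb da db).
  apply: (cvgr_to_le (parseval bw)).
  apply: nearW => N; apply: (@le_trans _ _ (\sum_(k < N) (beta / 2) ^+ 2 * inner F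
    (cos_mode k) ^+ 2)).
    exact: ler_sum.
  rewrite -mulr_sumr ler_wpM2l ?sqr_ge0//.
  exact: (bessel (@bm_cos_mode R) (@cos_mode_orthonormal R) N bF).
have /(ae_eq_inner0 bw) : inner w w = 0.
  by apply/eqP; rewrite eq_le inner_ge0 andbT; lra.
by apply: filterS => u h Lu; apply/eqP; rewrite -subr_eq0; apply/eqP; exact: h.
Qed.

End Stationary.

End Kernel.

End WeakForms.

(** * Existence of a stationary solution *)

Section RealCalculus.
Context {R : realType}.
Local Notation mu := (@lebesgue_measure R).
Local Notation bm := bounded_measurable.
Implicit Types (f g F : R -> R).

(** Differentiability from a quadratic error bound; it handles the kink of [Num.min y 0] inside the
    square by sign cases alone. *)
Lemma is_derive_quadratic g (x d C : R) :
  (forall h, `|h| <= 1 -> `|g (x + h) - g x - h * d| <= C * h ^+ 2) -> is_derive x 1 g d.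
Proof.
move=> H; have C0 : 0 <= C.
  have := H 1; rewrite normr1 lexx expr1n mulr1 => /(_ isT).
  exact: le_trans.
have cv : h^-1 *: (g (h *: 1 + x) - g x) @[h --> 0^'] --> d.
  apply/cvgrPdist_le => eps e0.
  near=> h.
  have h0 : h != 0 by near: h; exact: nbhs_dnbhs_neq.
  have h1 : `|h| <= 1.
    by near: h; apply: dnbhs0_le.
  have he : `|h| <= eps / (C + 1).
    by near: h; apply: dnbhs0_le; rewrite divr_gt0//; lra.
  rewrite /GRing.scale /= mulr1 -normrN opprB.
  have -> : h^-1 * (g (h + x) - g x) - d = h^-1 * (g (x + h) - g x - h * d).
    by rewrite (addrC h) [RHS]mulrBr mulrA mulVf// mul1r.
  rewrite normrM normfV ler_pdivrMl ?normr_gt0//.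
  apply: le_trans (H h h1) _.
  rewrite -(real_normK (num_real h)) expr2 mulrCA ler_wpM2l//.
  apply: (@le_trans _ _ (C * (eps / (C + 1)))); first by rewrite ler_wpM2l.
  have C1 : 0 < C + 1 by lra.
  by rewrite mulrCA ler_piMr ?(ltW e0)// ler_pdivrMr// mul1r lerDl.
by apply: DeriveDef; [apply/cvg_ex; exists d|exact/cvg_lim].
Unshelve. all: by end_near. Qed.

Lemma MVT_le F f (a b C : R) : a <= b -> 
  (forall x : R, a <= x <= b -> is_derive x 1 F (f x)) ->
  (forall x : R, a <= x <= b -> `|f x| <= C) -> `|F b - F a| <= C * (b - a).
Proof.
move=> ab dF fC.
have cF : {within `[a, b], continuous F}.
  apply: continuous_in_subspaceT => x; rewrite inE/= in_itv/= => xab.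
  by apply/differentiable_continuous/derivable1_diffP; have [] := dF x xab.
have [||c cab ->] := @MVT_segment _ F f a b ab.
- by move=> x; rewrite in_itv/= => /andP[x1 x2]; apply: dF; rewrite !ltW.
- exact: cF.
by rewrite normrM (@ger0_norm _ (b - a)) ?subr_ge0// ler_wpM2r ?subr_ge0// fC//; move:
  cab; rewrite in_itv.
Qed.

Lemma MVT_ge0 F f (a b : R) : a <= b -> 
  (forall x : R, a <= x <= b -> is_derive x 1 F (f x)) ->
  (forall x : R, a <= x <= b -> 0 <= f x) -> F a <= F b.
Proof.
move=> ab dF f0.
have cF : {within `[a, b], continuous F}.
  apply: continuous_in_subspaceT => x; rewrite inE/= in_itv/= => xab.
  by apply/differentiable_continuous/derivable1_diffP; have [] := dF x xab.
have [||c cab E] := @MVT_segment _ F f a b ab.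
- by move=> x; rewrite in_itv/= => /andP[x1 x2]; apply: dF; rewrite !ltW.
- exact: cF.
by rewrite -subr_ge0 E mulr_ge0 ?subr_ge0// f0//; move: cab; rewrite in_itv.
Qed.

Lemma is_derive_sqr_negpart (x : R) :
  is_derive x 1 (fun y : R => Num.min y 0 ^+ 2) (2 * Num.min x 0).
Proof.
apply: (@is_derive_quadratic _ _ _ 1) => h _.
rewrite mul1r; have [x0|x0] := leP x 0; have [y0|y0] := leP (x + h) 0;
  rewrite ler_norml; apply/andP; split; nra.
Qed.

(* [h = min(psi, 0)^2] has derivative [2 c min(psi, 0)], so it is monotone;
   it vanishes at both ends, hence everywhere. *)
Lemma weak_minimum_principle (psi f : R -> R) (c a b : R) :
  (forall x : R, a <= x <= b -> is_derive x 1 psi (f x + c)) ->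
  (forall x, a <= x <= b -> psi x <= 0 -> f x = 0) ->
  0 <= psi a -> 0 <= psi b -> forall x, a <= x <= b -> 0 <= psi x.
Proof.
move=> dpsi f0 pa pb x /andP[ax xb].
pose h y := Num.min (psi y) 0 ^+ 2.
have dh (y : R) : a <= y <= b -> is_derive y 1 h (2 * c * Num.min (psi y) 0).
  move=> yab; have h1 := dpsi y yab; have h2 := is_derive_sqr_negpart (psi y).
  apply: is_derive_eq (@is_derive1_comp _ _ psi y _ _ h2 h1) _.
  (* Where [psi] is at most 0 the term [f] vanishes by assumption; elsewhere the factor
     [Num.min (psi y) 0] does. *)
  by have [p0|p0] := leP (psi y) 0; [rewrite f0//; ring | ring].
have m0 y : Num.min (psi y) 0 <= 0 by rewrite ge_min lexx orbT.
have hx : h x <= 0.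
  have [c0|c0] := leP 0 c.
    have <- : h a = 0 by rewrite /h min_r// expr0n.
    rewrite -lerN2; apply: (@MVT_ge0 (fun y => - h y) (fun y => - (2 * c * Num.min (psi
      y) 0)) _ _ ax).
      move=> y /andP[ay yx]; have := dh y; rewrite ay (le_trans yx xb) => /(_ isT) d.
      exact: is_deriveN.
    by move=> y _; have := m0 y; nra.
  have <- : h b = 0 by rewrite /h min_r// expr0n.
  apply: (MVT_ge0 xb) => y /andP[xy yb].
    by apply: dh; rewrite yb (le_trans ax xy).
  by have := m0 y; nra.
have : h x = 0 by apply/eqP; rewrite eq_le hx sqr_ge0.
move=> /eqP; rewrite sqrf_eq0 leNgt => /eqP m0x; apply/negP => p0.
by move: m0x; rewrite (min_l (ltW p0)) => p0'; move: p0; rewrite p0' ltxx.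
Qed.

(** The base point -3/2 lies left of -1, so the primitive has a two-sided derivative on all of
    [-1,1]; only its increments from -1 are used. *)
Definition primitive F (x : R) : R := \int[mu]_(t in `[(-3 / 2)%R, x]) F t.

Lemma is_derive_primitive F (x : R) : (forall u, -2 < u < 2 -> {for u, continuous F}) ->
  -3 / 2 < x < 3 / 2 -> is_derive x 1 (primitive F) (F x).
Proof.
move=> cF /andP[x1 x2].
have iF : mu.-integrable `[(-3 / 2)%R, (3 / 2)%R] (EFin \o F).
  apply: continuous_compact_integrable; first exact: segment_compact.
  apply: continuous_in_subspaceT => u; rewrite inE/= in_itv/= => hu.
  by apply: cF; lra.
have cx : {for x, continuous F} by apply: cF; lra.
have [d1 d2] := continuous_FTC1_closed x2 iF x1 cx.
by apply: DeriveDef; [exact: d1|rewrite -derive1E; exact: d2].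
Qed.

(** The intervals with centre u_n and radius 2C/2^n are nested because each step is at most half the
    radius; the limit of their left ends lies in all of them, which also gives the error bound. *)
Lemma geometric_step_limit (u : nat -> R) (C : R) :
  (forall n, `|u n.+1 - u n| <= C / 2 ^+ n) ->
  exists l, forall n, `|u n - l| <= 2 * C / 2 ^+ n.
Proof.
move=> hu.
have e n : 2 * C / 2 ^+ n.+1 = C / 2 ^+ n.
  by rewrite exprS; field; rewrite expf_neq0.
have e2 n : 2 * C / 2 ^+ n = 2 * (C / 2 ^+ n) by rewrite mulrA.
pose lo n := u n - 2 * C / 2 ^+ n.
pose up n := u n + 2 * C / 2 ^+ n.
have lo_nd : nondecreasing_seq lo.
  apply/nondecreasing_seqP => n; rewrite /lo e e2.
  by have := hu n; rewrite ler_norml; lra.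
have up_ni : nonincreasing_seq up.
  apply/nonincreasing_seqP => n; rewrite /up e e2.
  by have := hu n; rewrite ler_norml; lra.
have C0 n : 0 <= 2 * C / 2 ^+ n by rewrite e2; have := le_trans (normr_ge0 _) (hu n); lra.
have loup n k : lo n <= up k.
  apply: (@le_trans _ _ (lo (maxn n k))); first exact/lo_nd/leq_maxl.
  apply: (@le_trans _ _ (up (maxn n k))); last exact/up_ni/leq_maxr.
  by rewrite /lo /up; have := C0 (maxn n k); lra.
have cl : cvgn lo.
  apply: nondecreasing_is_cvgn => //; exists (up 0%N) => _ [n _ <-].
  exact: loup.
exists (limn lo) => n.
have h1 : lo n <= limn lo by exact: nondecreasing_cvgn_le.
have h2 : limn lo <= up n by apply: limr_le => //; apply: nearW => k; exact: loup.
by move: h1 h2; rewrite /lo /up ler_norml; lra.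
Qed.

End RealCalculus.

(** * The fixed point of the integrated equation *)

Section Existence.
Context {R : realType}.
Local Notation mu := (@lebesgue_measure R).
Local Notation L := (@Lambda R).
Local Notation bm := bounded_measurable.
Implicit Types (m : R -> R).

(** Extends functions on [-1,1] by their end values, so that the iteration acts on continuous
    functions on the whole line. *)
Definition proj (x : R) : R := Num.max (-1) (Num.min 1 x).

Lemma proj_in (x : R) : -1 <= proj x <= 1.
Proof. by rewrite /proj le_max lexx /= ge_max ltW ?ltN11//= ge_min lexx. Qed.

Lemma proj_id (x : R) : -1 <= x <= 1 -> proj x = x.
Proof. by move=> /andP[x0 x1]; rewrite /proj min_r// max_r. Qed.

Lemma continuous_proj : continuous proj.
Proof.
move=> x; rewrite (_ : proj = fun u => Num.max (-1) (Num.min 1 u))//.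
apply: (@continuous_max R R (cst (-1)) (fun u => Num.min 1 u)).
  exact: cst_continuous.
apply: (@continuous_min R R (cst 1) id); last exact: cvg_id.
exact: cst_continuous.
Qed.

Lemma affine_correction_lip (rm D p q p' q' s y : R) : -1 <= y <= 1 ->
  `|p - p'| <= s / 4 -> `|q - q'| <= s / 4 ->
  `|rm + p + (D - q) / 2 * (y + 1) - (rm + p' + (D - q') / 2 * (y + 1))| <= s / 2.
Proof.
move=> hy hp hq.
have -> : rm + p + (D - q) / 2 * (y + 1) - (rm + p' + (D - q') / 2 * (y + 1))
  = (p - p') - (q - q') * ((y + 1) / 2) by field.
apply: le_trans (ler_normB _ _) _.
have : `|(q - q') * ((y + 1) / 2)| <= s / 4.
  have := normr_ge0 (q - q').
  by rewrite normrM (@ger0_norm _ (_ / 2)); [nra|lra].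
by lra.
Qed.

Variables (J K : R -> R -> R) (B : R).
Hypothesis cK : continuous (fun p : R * R => K p.1 p.2).
Hypothesis B0 : 0 <= B.
Hypothesis KB : forall u v : R, -2 <= u <= 2 -> -2 <= v <= 2 -> `|K u v| <= B.
Hypothesis cJ : continuous (fun p : R * R => Jneum J p.1 p.2).
Hypothesis dJ : forall u v : R, is_derive u 1 (fun x => Jneum J x v) (K u v).
Variables (beta rhom rhop : R).
Hypothesis hbeta : small_coupling B beta.
Hypothesis hm : 0 < rhom < 1.
Hypothesis hp : 0 < rhop < 1.

(** One integration of the stationary equation gives rho' = drift + constant, because beta rho (1 -
    rho) is beta/2 times [sigma]. In [profile] the value at -1 is [rhom], and [slope] is the
    constant that makes the value at 1 equal to [rhop]. *)
Let drift m (u : R) := beta / 2 * flux K (clamp01 \o m) u.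
Let P m := primitive (drift m).
Let slope m : R := (rhop - rhom - (P m 1 - P m (-1))) / 2.
Let profile m (x : R) : R := rhom + (P m x - P m (-1)) + slope m * (x + 1).
Let step m (x : R) : R := profile m (proj x).

Let measurable_cont m : continuous m -> measurable_fun L m.
Proof. by move=> cm; apply: measurable_funTS; exact: continuous_measurable_fun. Qed.

Let drift_cont m : continuous m -> forall u : R, -2 < u < 2 -> {for u, continuous (drift
  m)}.
Proof.
move=> cm u hu.
have bc := density_bm (density_clamp01 (measurable_cont cm)).
have cc : {for u, continuous (clamp01 \o m)}.
  by apply: continuous_comp; [exact: cm | exact: continuous_clamp01].
apply: cvgM; first exact: cvg_cst.
apply: cvgM; last exact: (continuous_nonlocal_grad cK KB).
apply: cvgM; first by apply: cvgM; [exact: cvg_cst|exact: cc].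
by apply: cvgB; [exact: cvg_cst|exact: cc].
Qed.

(** [flux_diff] gives 4B s + (B/2)(2s) = 5B s, and beta/2 times 5B is at most 1/8 exactly when beta
    B <= 1/20: this is the origin of the 20 in [small_coupling]. Integration over length at most 2
    gives s/4, and the two primitive terms of [profile] together give s/2. *)
Let drift_lip m m' (s u : R) : continuous m -> continuous m' ->
  (forall x, `|m x - m' x| <= s) -> -1 <= u <= 1 ->
  `|drift m u - drift m' u| <= s / 8.
Proof.
move=> cm cm' ms hu.
have da := density_clamp01 (measurable_cont cm).
have db := density_clamp01 (measurable_cont cm').
have s0 : 0 <= s := le_trans (normr_ge0 _) (ms 0).
have h2 : -2 <= u <= 2 by lra.
have := flux_diff cK B0 KB da db h2 (clamp01_in _) (clamp01_in _).
have cs x : `|(clamp01 \o m) x - (clamp01 \o m') x| <= s.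
  exact: le_trans (clamp01_lip _ _) (ms x).
have := L1_bound (bmB (density_bm da) (density_bm db)) (fun x _ => cs x).
set I := \int[mu]_(v in L) _ => Is fd.
rewrite /drift -mulrBr normrM; have [b0 b1] := hbeta.
rewrite (@ger0_norm _ (beta / 2)); last by lra.
have h5 : `|flux K (clamp01 \o m) u - flux K (clamp01 \o m') u| <= 5 * B * s.
  apply: le_trans fd _.
  apply: (@le_trans _ _ (4 * B * s + B / 2 * (2 * s))); last by lra.
  by apply: lerD; apply: ler_wpM2l => //; [exact: mulr_ge0|exact: divr_ge0].
apply: (@le_trans _ _ (beta / 2 * (5 * B * s))).
  by rewrite ler_wpM2l//; lra.
have bB : beta * B * 20 <= 1 by lra.
have := ler_wpM2r s0 bB; lra.
Qed.

Let dP m (x : R) : continuous m -> -1 <= x <= 1 -> is_derive x 1 (P m) (drift m x).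
Proof. by move=> cm hx; apply: is_derive_primitive; [exact: drift_cont|lra]. Qed.

Let P_lip m m' (s y : R) : continuous m -> continuous m' ->
  (forall x, `|m x - m' x| <= s) -> -1 <= y <= 1 ->
  `|(P m y - P m (-1)) - (P m' y - P m' (-1))| <= s / 4.
Proof.
move=> cm cm' ms hy.
have s0 : 0 <= s := le_trans (normr_ge0 _) (ms 0).
have subACA (p q p' q' : R) : p - q - (p' - q') = p - p' - (q - q') by ring.
rewrite subACA.
have y1 : -1 <= y by lra.
have := @MVT_le R (fun x => P m x - P m' x) (fun x => drift m x - drift m' x) (-1) y (s /
  8) y1.
have dd (x : R) : -1 <= x <= y -> is_derive x 1 (fun x => P m x - P m' x) (drift m x -
  drift m' x).
  move=> hx; have h1 : -1 <= x <= 1 by lra.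
  by have d1 := dP cm h1; have d2 := dP cm' h1; exact: is_deriveB.
have db (x : R) : -1 <= x <= y -> `|drift m x - drift m' x| <= s / 8.
  by move=> hx; apply: drift_lip => //; lra.
move=> /(_ dd db) h; apply: le_trans h _.
by have : s / 8 * (y - -1) <= s / 8 * 2 by [rewrite ler_wpM2l//; lra]; lra.
Qed.

Let step_lip m m' (s x : R) : continuous m -> continuous m' ->
  (forall x, `|m x - m' x| <= s) -> `|step m x - step m' x| <= s / 2.
Proof.
move=> cm cm' ms; have hy := proj_in x.
have h11 : -1 <= (1 : R) <= 1 by lra.
exact: affine_correction_lip hy (P_lip cm cm' ms hy) (P_lip cm cm' ms h11).
Qed.

Let step_cont m : continuous m -> continuous (step m).
Proof.
move=> cm x; apply: (@continuous_comp _ _ _ proj (profile m)); first exact: continuous_proj.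
have h := dP cm (proj_in x).
have cP : {for proj x, continuous (P m)}.
  by apply/differentiable_continuous/derivable1_diffP; have [] := h.
apply: cvgD.
  by apply: cvgD; [exact: cvg_cst|apply: cvgB; [exact: cP|exact: cvg_cst]].
by apply: cvgM; [exact: cvg_cst|apply: cvgD; [exact: cvg_id|exact: cvg_cst]].
Qed.

Let iter_step (n : nat) : R -> R := iter n step (cst 0).

Let iter_cont n : continuous (iter_step n).
Proof. by elim: n => [|n IH]; [exact: cst_continuous|exact: step_cont]. Qed.

Let iter_diff n x : `|iter_step n.+1 x - iter_step n x| <= 1 / 2 ^+ n.
Proof.
elim: n x => [|n IH] x; last first.
  have h := step_lip x (@iter_cont n.+1) (@iter_cont n) IH.
  change (`|step (iter_step n.+1) x - step (iter_step n) x| <= 1 / 2 ^+ n.+1).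
  by apply: le_trans h _; rewrite exprS invfM !mul1r mulrC.
(* The drift of the zero function vanishes since [sigma] is 0 at 0, so the first iterate
   interpolates linearly between [rhom] and [rhop] and lies in [0,1]. *)
rewrite /iter_step /= subr0 expr0 divr1.
have d0 : drift (cst 0) = cst 0.
  apply/funext => u; rewrite /drift /flux /= clamp01_le0// /sigma.
  by rewrite mulr0 !mul0r mulr0.
have P0 y : P (cst 0) y = 0.
  by rewrite /P d0 /primitive Rintegral_cst ?mul0r//; exact: measurable_itv.
rewrite /step /profile /slope !P0 !subr0 addr0.
have := proj_in x; move: (proj x) => y hy.
have [m0 m1] := andP hm; have [p0 p1] := andP hp.
have y0 : 0 <= y + 1 by lra.
have y1 : 0 <= 1 - y by lra.
have h1 := mulr_ge0 (ltW m0) y1; have h2 := mulr_ge0 (ltW p0) y0.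
have h3 : 0 <= (1 - rhom) * (1 - y) by apply: mulr_ge0 => //; lra.
have h4 : 0 <= (1 - rhop) * (y + 1) by apply: mulr_ge0 => //; lra.
by rewrite ler_norml; apply/andP; split; lra.
Qed.

Let fixed_point : exists2 rho, continuous rho & forall x, rho x = step rho x.
Proof.
have /choice[rho hrho] : forall x, exists l, forall n, `|iter_step n x - l| <= 2 * 1 / 2
  ^+ n.
  by move=> x; apply: geometric_step_limit => n; exact: iter_diff.
have small (e : R) : 0 < e -> exists n, 2 * 1 / 2 ^+ n <= e.
  move=> e0.
  have /cvgrPdist_le/(_ e e0)[n _ /(_ n (leqnn n))] :
    geometric (2 * 1) (2^-1) n @[n --> \oo] --> (0 : R).
    by apply: cvg_geometric; rewrite ger0_norm//; lra.
  by rewrite sub0r normrN /geometric /= exprVn => h; exists n; exact: le_trans (ler_norm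
    _) h.
(* The error bound does not depend on the point, so the convergence is uniform and an e/3 argument
   applies. *)
have crho : continuous rho.
  move=> x; apply/cvgrPdist_le => e e0.
  have [n hn] := small (e / 3) (divr_gt0 e0 (ltr0n _ 3)).
  have /cvgrPdist_le/(_ (e / 3) (divr_gt0 e0 (ltr0n _ 3))) := @iter_cont n x.
  apply: filterS => y; have := hrho x n; have := hrho y n.
  rewrite !ler_norml; lra.
exists rho => // x; apply/eqP; rewrite -subr_eq0 -normr_eq0 eq_le normr_ge0 andbT.
apply/ler_addgt0Pl => e e0; rewrite addr0.
have [n hn] := small (e / 2) (divr_gt0 e0 (ltr0n _ 2)).
have h0 y : `|iter_step n y - rho y| <= e / 2 by exact: le_trans (hrho y n) hn.
have h1 := step_lip x (@iter_cont n) crho h0.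
have h2 : `|iter_step n.+1 x - rho x| <= e / 2.
  apply: le_trans (hrho x n.+1) _; apply: le_trans hn.
  by rewrite ler_pM2l ?lef_pV2 ?posrE ?exprn_gt0// exprS ler_peMl ?exprn_ge0//; lra.
have tri (p q r : R) : `|p - q| <= e / 2 / 2 -> `|p - r| <= e / 2 -> `|r - q| <= e.
  by move=> {h1 h2}; rewrite !ler_norml; lra.
exact: tri h1 h2.
Qed.

Lemma stationary_profile_exists : exists (psi F : R -> R) (c : R),
  [/\ forall x : R, -1 <= x <= 1 -> is_derive x 1 psi (F x + c),
      forall x : R, -1 <= x <= 1 -> 0 <= psi x <= 1,
      psi (-1) = rhom /\ psi 1 = rhop,
      {within (@Lambda_bar R), continuous F} &
      forall x, L x -> F x = beta / 2 * flux K psi x].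
Proof.
have [rho crho rhoE] := fixed_point.
have [/ltW m0 /ltW m1] := andP hm; have [/ltW p0 /ltW p1] := andP hp.
(* The fixed point is constant beyond -1 and 1 and may have kinks there; the unprojected profile
   agrees with it on [-1,1] and is differentiable at the ends. *)
pose psi := profile rho.
have psiE (x : R) : -1 <= x <= 1 -> rho x = psi x by move=> hx; rewrite rhoE /step proj_id.
have dpsi (x : R) : -1 <= x <= 1 -> is_derive x 1 psi (drift rho x + slope rho).
  move=> hx; have h := dP crho hx; rewrite /psi /profile; apply: is_derive_eq.
  by rewrite /GRing.scale /=; move: (drift rho x) (slope rho) => p q; ring.
have pm : psi (-1) = rhom by rewrite /psi /profile subrr addNr mulr0 !addr0.
have pp : psi 1 = rhop by rewrite /psi /profile /slope; move: (P rho 1 - _) => p; field.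
have drift0 (x : R) : -1 <= x <= 1 -> (psi x <= 0) || (1 <= psi x) -> drift rho x = 0.
  move=> hx; rewrite /drift /flux /= (psiE _ hx) => /orP[/clamp01_le0 ->|/clamp01_ge1 ->].
    by rewrite /sigma mulr0 !mul0r mulr0.
  by rewrite /sigma subrr mulr0 mul0r mulr0.
have psi_ge0 : forall x : R, -1 <= x <= 1 -> 0 <= psi x.
  apply: (weak_minimum_principle dpsi); rewrite ?pm ?pp ?m0 ?p0//.
  by move=> x hx q0; apply: drift0 => //; rewrite q0.
have dpsi' (x : R) : -1 <= x <= 1 ->
    is_derive x 1 (fun x => 1 - psi x) (- drift rho x + - slope rho).
  move=> hx; have h := dpsi x hx; apply: is_derive_eq.
  by rewrite add0r mul1r opprD.
have drift0' (x : R) : -1 <= x <= 1 -> 1 - psi x <= 0 -> - drift rho x = 0.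
  by move=> hx; rewrite subr_le0 => q0; rewrite drift0 ?oppr0// q0 orbT.
have psi_le1 : forall x : R, -1 <= x <= 1 -> 0 <= 1 - psi x.
  by apply: (weak_minimum_principle dpsi' drift0'); rewrite subr_ge0 ?pm ?pp.
have psi01 (x : R) : -1 <= x <= 1 -> 0 <= psi x <= 1.
  by move=> hx; rewrite psi_ge0//= -subr_ge0 psi_le1.
exists psi, (drift rho), (slope rho); split=> //.
- apply: continuous_in_subspaceT => u; rewrite inE /Lambda_bar/= in_itv/= => hu.
  by apply: drift_cont => //; lra.
- have Lin (x : R) : L x -> -1 <= x <= 1 by rewrite /Lambda/= in_itv/=; lra.
  have E x : L x -> (clamp01 \o rho) x = psi x.
    by move=> /Lin hx; rewrite /= psiE// clamp01_id// psi01.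
  move=> x Lx; rewrite /drift /flux E//; congr (_ * (_ * _)).
  by apply: eq_Rintegral => v; rewrite inE => Lv; rewrite E.
Qed.

Lemma stationary_solution_exists : exists rho, stationary_solution J beta rhom rhop rho.
Proof.
have [psi [F [c [dpsi psi01 [pm pp] cF FE]]]] := stationary_profile_exists.
have Lin (x : R) : L x -> -1 <= x <= 1 by rewrite /Lambda/= in_itv/=; lra.
have dL (x : R) : L x -> is_derive x 1 psi (F x + c) by move=> /Lin; exact: dpsi.
have cpsi : {within (@Lambda_bar R), continuous psi}.
  apply: continuous_in_subspaceT => u; rewrite inE /Lambda_bar/= in_itv/= => hu.
  by apply/differentiable_continuous/derivable1_diffP; have [] := dpsi u hu.
have cc (a : R) : {within (@Lambda_bar R), continuous (cst a)}.
  by apply: continuous_subspaceT => x; exact: cst_continuous.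
have cFc : {within (@Lambda_bar R), continuous (fun x => F x + c)}.
  by move=> x; apply: cvgD; [exact: cF|exact: cc].
have bpsi := within_continuous_bm cpsi.
have bF := within_continuous_bm cF.
have bFc := within_continuous_bm cFc.
have L2b f : bm L f -> L2 f.
  move=> bf; split; first by case: bf.
  by rewrite (L2normE (ae_eq_refl _ _ _) bf) ltry.
exists psi; split.
- exists (fun x => F x + c); split; [exact: L2b|exact: L2b|].
  move=> phi [dphi [D [cD DL] phi0]].
  have d0 (x : R) : derivable phi x 1 by exact: (dphi 0%N).
  have d1 (x : R) : derivable (derive1 phi) x 1 by exact: (dphi 1%N).
  have cphi (g : R -> R) : (forall x : R, derivable g x 1) -> {within (@Lambda_bar R),
    continuous g}.
    move=> dg; apply: continuous_subspaceT => x.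
    by apply/differentiable_continuous/derivable1_diffP.
  have dphi' (x : R) : L x -> is_derive x 1 phi (derive1 phi x).
    by move=> _; rewrite derive1E; apply: DeriveDef.
  rewrite (inner_by_parts cpsi cFc dL (cphi _ d0) (cphi _ d1) dphi').
  rewrite !phi0; last 2 first.
  + by move=> /DL; rewrite /Lambda/= in_itv/= ltxx.
  + by move=> /DL; rewrite /Lambda/= in_itv/= ltxx andbF.
  by rewrite !mulr0 subrr sub0r.
- by apply: aeW => u /Lin; exact: psi01.
- move=> G G1 G2 [[cG cG1 cG2] [dG dG1 [Gm Gp]]].
  have mpsi : measurable_fun L psi by case: bpsi.
  have ae01 : {ae mu, forall u, L u -> 0 <= psi u <= 1}.
    by apply: aeW => u /Lin; exact: psi01.
  rewrite (inner_drift B0 KB cJ dJ G1 mpsi ae01).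
  rewrite (inner_by_parts cpsi cFc dL cG1 cG2 dG1) pm pp.
  have bG1 := within_continuous_bm cG1.
  rewrite innerDl//; last exact: bm_cst.
  (* The unknown constant of integration is invisible to the weak form because [G] vanishes at both
     ends. *)
  have -> : inner (cst c) G1 = 0.
    have d0 (x : R) : L x -> is_derive x 1 (cst c) (cst 0 x) by move=> _; exact:
      is_derive_cst.
    rewrite (inner_by_parts (cc c) (cc 0) d0 cG cG1 dG) Gm Gp !mulr0 subrr sub0r.
    rewrite /inner; under eq_Rintegral do rewrite mul0r.
    by rewrite Rintegral_cst ?mul0r ?oppr0//; exact: measurable_Lambda.
  have bfl : bm L (flux K (clamp01 \o psi)).
    by apply: (bm_flux cK KB); exact: density_clamp01.
  have -> : inner F G1 = beta / 2 * inner (flux K (clamp01 \o psi)) G1.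
    rewrite innerC [in RHS]innerC -innerZr//.
    apply: eq_Rintegral => x; rewrite inE => Lx; congr (_ * _).
    rewrite FE//; congr (_ * (_ * _)).
      by rewrite /= clamp01_id// psi01//; exact: Lin.
    apply: eq_Rintegral => v; rewrite inE => Lv.
    by rewrite /= clamp01_id// psi01//; exact: Lin.
  ring.
Qed.

End Existence.

(** * Measurability of integrals depending on a parameter *)

Section ParametricIntegral.
Context {R : realType}.
Local Notation mu := (@lebesgue_measure R).
Local Notation L := (@Lambda R).
Local Notation bm := bounded_measurable.

Lemma bm_section d (X : measurableType d) (S : set X) (g : X -> R -> R) (M : R) (x : X) :
  measurable S ->
  measurable_fun (S `*` L) (fun p : X * R => g p.1 p.2) ->
  (forall x v, S x -> L v -> `|g x v| <= M) -> S x -> bm L (g x).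
Proof.
move=> mS mg gM Sx; split; last by exists M => v; exact: gM.
have := @measurable_comp _ _ _ _ _ _ (S `*` L) (fun p : X * R => g p.1 p.2) L (pair x).
apply => //.
- by apply: measurableX => //; exact: measurable_Lambda.
- by move=> _ [v Lv <-].
- exact: measurable_funTS.
Qed.

(** Adding [M] makes the integrand nonnegative, so Tonelli's theorem gives measurability; the
    constant [M * 2] subtracted afterwards is the integral of [M] over an interval of length 2. *)
Lemma measurable_parametric_integral d (X : measurableType d) (S : set X)
    (g : X -> R -> R) (M : R) :
  measurable S ->
  measurable_fun (S `*` L) (fun p : X * R => g p.1 p.2) ->
  (forall x v, S x -> L v -> `|g x v| <= M) ->
  measurable_fun S (fun x => \int[mu]_(v in L) g x v).
Proof.
move=> mS mg gM; have mL := @measurable_Lambda R.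
pose G (p : X * R) : \bar R := (((fun p => g p.1 p.2 + M) \_ (S `*` L)) p)%:E.
have mG : measurable_fun setT G.
  apply/measurable_EFinP; apply/(measurable_restrictT _ _).1.
    exact: measurableX.
  by apply: measurable_funD => //; exact: measurable_cst.
have G0 p : (0 <= G p)%E.
  rewrite lee_fin patchE; case: ifPn => //; rewrite inE => -[Sp Lp].
  by have := gM _ _ Sp Lp; rewrite ler_norml; lra.
have := @measurable_fun_fubini_tonelli_F _ _ X (measurableTypeR R) R mu G mG G0.
move=> mF.
have : measurable_fun S (fun x => fine (fubini_F mu G x) - M * 2).
  apply: measurable_funB; last exact: measurable_cst.
  apply: measurable_funTS; apply: measurableT_comp => //.
apply: eq_measurable_fun => x; rewrite inE => Sx.
have bg := bm_section mS mg gM Sx.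
rewrite /fubini_F.
have -> : (\int[mu]_y G (x, y) = \int[mu]_(y in L) (g x y + M)%:E)%E.
  rewrite [RHS]integral_mkcond; apply: eq_integral => y _.
  rewrite /G !patchE /=; case: ifPn => [|].
    by rewrite inE => -[_ Ly]; rewrite mem_set.
  move=> h; case: ifPn => //; rewrite inE => Ly.
  by move: h; rewrite mem_set.
rewrite -/(Rintegral mu L (fun y => g x y + M)).
rewrite RintegralD//; [|exact: bmL_integrable|exact/bmL_integrable/bm_cst].
by rewrite Rintegral_cst// -[X in fine X]/(mu L) mu_Lambda /= addrK.
Qed.

End ParametricIntegral.

(** * Decay of the evolution *)

Section TimeIntegral.
Context {R : realType}.
Local Notation mu := (@lebesgue_measure R).
Local Notation bm := bounded_measurable.
Implicit Types (f g : R -> R).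

Lemma mu_itvcc (s t : R) : s <= t -> mu `[s, t] = (t - s)%:E.
Proof.
move=> st; rewrite lebesgue_measure_itv/= lte_fin -EFinB.
by case: ltP => // ts; congr EFin; apply/eqP; rewrite eq_sym subr_eq0 eq_le ts st.
Qed.

Lemma bm_itv_integrable (s t : R) f : bm `[s, t] f -> mu.-integrable `[s, t] (EFin \o f).
Proof.
move=> bf; apply: bm_integrable => //.
by rewrite [X in (X < _)%E]lebesgue_measure_itv/=; case: ifP => _; rewrite -?EFinB ltry.
Qed.

Lemma Rintegral_itv_cat (s r t : R) f : s <= r -> r <= t -> bm `[s, t] f ->
  \int[mu]_(x in `[s, t]) f x = \int[mu]_(x in `[s, r]) f x + \int[mu]_(x in `[r, t]) f x.
Proof.
move=> sr rt bf; have iF := bm_itv_integrable bf.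
have sub : [set` `[r, t]] `<=` [set` `[s, t]] by apply: subset_itvr; rewrite bnd_simp.
rewrite -(@Rintegral_itv_obnd_cbnd _ r); last first.
  apply: bm_integrable => //.
    by rewrite [X in (X < _)%E]lebesgue_measure_itv/=; case: ifP => _; rewrite -?EFinB ltry.
  apply: bm_subset bf => //; apply: subset_trans sub; exact: subset_itv_oc_cc.
by rewrite -(Rintegral_itvB iF)// ?bnd_simp// addrC subrK.
Qed.

Lemma bm_itv_sub (s t s' t' : R) f : s <= s' -> t' <= t -> bm `[s, t] f -> bm `[s', t'] f.
Proof.
move=> ss tt; apply: bm_subset => //.
by move=> x /=; rewrite !in_itv/= => /andP[a b]; rewrite (le_trans ss a) (le_trans b tt).
Qed.

Lemma Rintegral_itv_cst (s t c : R) : s <= t -> \int[mu]_(x in `[s, t]) (cst c x) = c *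
  (t - s).
Proof.
by move=> st; rewrite Rintegral_cst// -[X in fine X]/(mu `[s, t]) mu_itvcc.
Qed.

Lemma normr_Rintegral_itv_le (s t M : R) f : s <= t -> bm `[s, t] f ->
  (forall x, s <= x <= t -> `|f x| <= M) ->
  `|\int[mu]_(x in `[s, t]) f x| <= M * (t - s).
Proof.
move=> st bf fM; rewrite -Rintegral_itv_cst//.
apply: (le_trans (@le_normr_Rintegral _ (measurableTypeR R) R mu _ f _ (bm_itv_integrable
  bf))) => //.
apply: le_Rintegral => //.
- exact: (integrable_norm (bm_itv_integrable bf)).
- by apply: bm_itv_integrable; exact: bm_cst.
Qed.

(** Cutting [s,t] into n + 1 equal pieces bounds the total increment by C (t-s)^2/(n+1). This
    replaces differentiation for functions that are only Lipschitz. *)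
Lemma quadratic_increment_cst (phi : R -> R) (s t C : R) : s <= t ->
  (forall x y, s <= x -> x <= y -> y <= t -> `|phi y - phi x| <= C * (y - x) ^+ 2) ->
  phi t = phi s.
Proof.
move=> st H; pose D := C * (t - s) ^+ 2.
have D0 : 0 <= D := le_trans (normr_ge0 _) (H s t (lexx _) st (lexx _)).
have bound n : `|phi t - phi s| <= D / n.+1%:R.
  pose d := (t - s) / n.+1%:R.
  have n0 : 0 < n.+1%:R :> R by rewrite ltr0n.
  have d0 : 0 <= d by rewrite divr_ge0 ?subr_ge0.
  have step k : (k <= n.+1)%N -> `|phi (s + k%:R * d) - phi s| <= k%:R * (C * d ^+ 2).
    elim: k => [|k IH] kn; first by rewrite !mul0r addr0 subrr normr0.
    have {}IH := IH (ltnW kn).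
    have le_end : s + k.+1%:R * d <= t.
      rewrite -lerBrDl /d mulrA ler_pdivrMr// mulrC ler_wpM2l ?subr_ge0//.
      by rewrite ler_nat.
    have e : s + k.+1%:R * d - (s + k%:R * d) = d by rewrite -natr1; ring.
    have k0 : 0 <= k%:R * d by rewrite mulr_ge0.
    have := H (s + k%:R * d) (s + k.+1%:R * d).
    rewrite lerDl k0 lerD2l ler_wpM2r ?ler_nat// => /(_ isT isT le_end).
    rewrite e => h.
    have -> : phi (s + k.+1%:R * d) - phi s =
      (phi (s + k.+1%:R * d) - phi (s + k%:R * d)) + (phi (s + k%:R * d) - phi s) by ring.
    apply: le_trans (ler_normD _ _) _.
    have -> : k.+1%:R * (C * d ^+ 2) = C * d ^+ 2 + k%:R * (C * d ^+ 2) by rewrite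
      -natr1; ring.
    exact: lerD.
  have := step n.+1 (leqnn _).
  have -> : s + n.+1%:R * d = t by rewrite /d mulrC divfK ?gt_eqF// addrC subrK.
  move/le_trans; apply; rewrite /d /D.
  by rewrite [leLHS](_ : _ = C * (t - s) ^+ 2 / n.+1%:R)//; field; rewrite gt_eqF.
apply/eqP; rewrite -subr_eq0 -normr_eq0 eq_le normr_ge0 andbT.
apply/ler_addgt0Pl => e e0; rewrite addr0.
near \oo => n.
apply: le_trans (bound n) _; rewrite ler_pdivrMr ?ltr0n// mulrC -ler_pdivrMr//.
have h : D / e <= n%:R by near: n; exact: nbhs_infty_ger.
by apply: le_trans h _; rewrite ler_nat.
Unshelve. all: by end_near. Qed.

Section SquareOfPrimitive.
Variables (T : R) (a H : R -> R).
Hypothesis T0 : 0 < T.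
Hypothesis bH : bm `[0, T] H.
Hypothesis aH : forall t, 0 <= t <= T -> a t - a 0 = \int[mu]_(x in `[0, t]) H x.

Lemma primitive_increment (s t : R) : 0 <= s -> s <= t -> t <= T ->
  a t - a s = \int[mu]_(x in `[s, t]) H x.
Proof.
move=> s0 st tT; have t0 := le_trans s0 st; have sT := le_trans st tT.
have ht := aH (introT andP (conj t0 tT)); have hs := aH (introT andP (conj s0 sT)).
have := Rintegral_itv_cat s0 st (bm_itv_sub (lexx 0) tT bH).
rewrite -ht -hs => E.
by rewrite -[RHS](addKr (a s - a 0)) -E; ring.
Qed.

Lemma bm_primitive : bm `[0, T] a.
Proof.
have iH := bm_itv_integrable bH.
have c := @parameterized_integral_continuous R 0 T H (ltW T0) iH.
have bP := continuous_bm c.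
have := bmD (bm_cst _ (a 0)) bP; apply: bm_ext => t.
by rewrite inE/= in_itv/= => ht; rewrite /parameterized_integral -aH//= addrC subrK.
Qed.

(** The chain rule for the square of a primitive of a bounded measurable function, which need not be
    differentiable at every point. *)
Lemma sqr_primitive (s t : R) : 0 <= s -> s <= t -> t <= T ->
  a t ^+ 2 - a s ^+ 2 = \int[mu]_(x in `[s, t]) (2 * (a x * H x)).
Proof.
move=> s0 st tT; have [mH [M HM]] := bH.
have b2 : bm `[0, T] (fun x => 2 * (a x * H x)).
  by apply: bmZ; apply: bmM => //; exact: bm_primitive.
have M0 : 0 <= M by apply: le_trans (HM 0 _) => //; rewrite /= in_itv/= lexx ltW.
have HMi x : 0 <= x -> x <= T -> `|H x| <= M.
  by move=> x0 xT; apply: HM; rewrite /= in_itv/= x0 xT.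
have lip x y : 0 <= x -> x <= y -> y <= T -> `|a y - a x| <= M * (y - x).
  move=> x0 xy yT; rewrite primitive_increment//.
  apply: normr_Rintegral_itv_le => //; first exact: bm_itv_sub bH.
  by move=> z /andP[xz zy]; apply: HMi; [exact: le_trans xz|exact: le_trans yT].
pose I x := \int[mu]_(r in `[s, x]) (2 * (a r * H r)).
have : a t ^+ 2 - I t = a s ^+ 2 - I s.
  (* With [a] frozen at [x], the increment is (a y - a x)^2 minus the freezing error; these
     contribute M^2 and 2 M^2 times (y - x)^2. *)
  apply: (@quadratic_increment_cst (fun x => a x ^+ 2 - I x) _ _ (3 * M ^+ 2) st).
  move=> x y sx xy yt.
  have x0 := le_trans s0 sx; have yT := le_trans yt tT.
  have bxy : bm `[x, y] H by exact: bm_itv_sub bH.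
  have bxya : bm `[x, y] (fun r => a r) by apply: bm_itv_sub bm_primitive.
  have -> : I y = I x + \int[mu]_(r in `[x, y]) (2 * (a r * H r)).
    by apply: Rintegral_itv_cat => //; exact: bm_itv_sub b2.
  have -> : \int[mu]_(r in `[x, y]) (2 * (a r * H r)) =
     \int[mu]_(r in `[x, y]) (2 * (a x * H r)) +
     \int[mu]_(r in `[x, y]) (2 * ((a r - a x) * H r)).
    rewrite -RintegralD//; first last.
    - apply: bm_itv_integrable; apply: bmZ; apply: bmM => //.
      by apply: bmB => //; exact: bm_cst.
    - apply: bm_itv_integrable; apply: bmZ; exact: bmZ.
    by apply: eq_Rintegral => r _; ring.
  rewrite RintegralZl//; last by apply: bm_itv_integrable; exact: bmZ.
  rewrite RintegralZl//; last exact: bm_itv_integrable.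
  rewrite -primitive_increment//.
  set E := \int[mu]_(r in _) _.
  have hE : `|E| <= 2 * (M * (y - x) * M) * (y - x).
    apply: normr_Rintegral_itv_le => //.
      apply: bmZ; apply: bmM => //; apply: bmB => //; exact: bm_cst.
    move=> r /andP[xr ry]; rewrite normrM ger0_norm// ler_wpM2l// normrM.
    rewrite ler_pM ?HMi ?(le_trans x0 xr) ?(le_trans ry yT)//.
    apply: le_trans (lip _ _ x0 xr (le_trans ry yT)) _.
    by rewrite ler_wpM2l// lerB.
  have hl := lip _ _ x0 xy yT.
  move: hE hl; move: E (I x) (a x) (a y) => E i p q hE hl.
  have -> : q ^+ 2 - (i + (2 * (p * (q - p)) + E)) - (p ^+ 2 - i) = (q - p) ^+ 2 - E by
    ring.
  apply: le_trans (ler_normB _ _) _.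
  have : `|(q - p) ^+ 2| <= (M * (y - x)) ^+ 2.
    by rewrite normrX lerXn2r ?nnegrE// mulr_ge0// subr_ge0.
  by lra.
have -> : I s = 0 by rewrite /I set_itv1 Rintegral_set1.
by rewrite -/(I t) => E; rewrite -[I t](subKr (a t ^+ 2)) E; ring.
Qed.

End SquareOfPrimitive.

(** From exp(-x/2) >= 1 - x/2 and (1 + x)(1 - x/2) >= 1 on [0,1]. *)
Lemma exp_le_power (x : R) : 0 <= x <= 1 -> expR (x / 2) <= 1 + x.
Proof.
move=> hx; have h := expR_ge1Dx (- (x / 2)).
have e0 := expR_gt0 (x / 2).
have : expR (x / 2) * expR (- (x / 2)) = 1 by rewrite -expRD subrr expR0.
have := ler_wpM2l (ltW e0) h.
move=> h1 h2; rewrite h2 in h1.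
have h3 : 0 < 1 - x / 2 by lra.
by rewrite -(ler_pM2r h3); nra.
Qed.

(* The inequality gives [y t (1 + (t - s) / 2) <= y s]; subdividing [0, T]
   turns the product of these factors into an exponential. *)
Lemma integral_gronwall (y Y : R -> R) (T : R) : 0 < T -> bm `[0, T] Y ->
  (forall t, 0 <= y t) -> {ae mu, forall t, 0 <= t <= T -> y t = Y t} ->
  (forall t, 0 <= t <= T -> 0 <= Y t) ->
  (forall s t, 0 <= s -> s <= t -> t <= T ->
     y t - y s <= - (2^-1 * \int[mu]_(x in `[s, t]) Y x)) ->
  y T <= expR (- (T / 4)) * y 0.
Proof.
move=> T0 bY y0 yY Y0 H.
have mono s t : 0 <= s -> s <= t -> t <= T -> y t <= y s.
  move=> s0 st tT; rewrite -subr_le0; apply: le_trans (H s t s0 st tT) _.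
  rewrite oppr_le0 mulr_ge0 ?invr_ge0// Rintegral_ge0// => x /=.
  by rewrite in_itv/= => /andP[sx xt]; rewrite Y0// (le_trans s0 sx) (le_trans xt tT).
have key s t : 0 <= s -> s <= t -> t <= T -> y t * (1 + (t - s) / 2) <= y s.
  move=> s0 st tT.
  have bY' : bm `[s, t] Y by exact: bm_itv_sub bY.
  (* [y] is nonincreasing and equals [Y] almost everywhere, so this maximum is [Y] almost everywhere
     while being at least [y t] at every point. *)
  have bmax : bm `[s, t] (fun x => Num.max (Y x) (y t)).
    have [mY [M YM]] := bY'; split.
      exact: (measurable_maxr mY (@measurable_cst _ _ _ _ _ (y t))).
    exists (Num.max M (y t)) => x hx; have := YM x hx; rewrite le_max.
    case: (leP (Y x) (y t)) => _ YxM; last by rewrite YxM.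
    by rewrite (@ger0_norm _ (y t))// lexx orbT.
  have : y t * (t - s) <= \int[mu]_(x in `[s, t]) Y x.
    rewrite -Rintegral_itv_cst//.
    have -> : \int[mu]_(x in `[s, t]) Y x = \int[mu]_(x in `[s, t]) Num.max (Y x) (y t).
      apply: ae_eq_Rintegral; apply: filterS yY => x hx /=.
      rewrite in_itv/= => /andP[sx xt].
      have x0 := le_trans s0 sx; have xT := le_trans xt tT.
      by rewrite max_l// -hx ?x0// mono.
    apply: le_Rintegral => //.
    - by apply: bm_itv_integrable; exact: bm_cst.
    - exact: bm_itv_integrable.
    - by move=> x _; rewrite le_max lexx orbT.
  by have := H s t s0 st tT; nra.
near \oo => n.
have n0 : 0 < n%:R :> R by rewrite ltr0n; near: n; exact: nbhs_infty_gt.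
have nT : T <= n%:R by near: n; exact: nbhs_infty_ger.
pose d := T / n%:R.
have d0 : 0 <= d by rewrite divr_ge0// ltW.
have d1 : d <= 1 by rewrite ler_pdivrMr// mul1r.
(* Each factor 1 + d/2 is bounded below by exp(d/4) through [exp_le_power], which halves the rate
   1/2. *)
have it k : (k <= n)%N -> y (k%:R * d) * expR (k%:R * (d / 4)) <= y 0.
  elim: k => [|k IH] kn; first by rewrite !mul0r expR0 mulr1.
  apply: le_trans (IH (ltnW kn)).
  have e : k.+1%:R * d - k%:R * d = d by rewrite -natr1; ring.
  have := key (k%:R * d) (k.+1%:R * d).
  rewrite mulr_ge0// ler_wpM2r ?ler_nat// e => /(_ isT isT) h.
  have {h}h : y (k.+1%:R * d) * (1 + d / 2) <= y (k%:R * d).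
    by apply: h; rewrite /d mulrA ler_pdivrMr// mulrC ler_wpM2l ?(ltW T0)// ler_nat.
  have -> : k.+1%:R * (d / 4) = d / 2 / 2 + k%:R * (d / 4) by rewrite -natr1; field.
  rewrite expRD mulrA ler_wpM2r ?expR_ge0//; apply: le_trans h.
  by rewrite ler_wpM2l// exp_le_power//; lra.
have := it n (leqnn n).
have -> : n%:R * d = T by rewrite /d mulrC divfK// gt_eqF.
have -> : n%:R * (d / 4) = T / 4 by rewrite /d; field; rewrite gt_eqF.
by rewrite expRN => h; rewrite mulrC ler_pdivlMr ?expR_gt0.
Unshelve. all: by end_near. Qed.

End TimeIntegral.

(** * The energy inequality from the mode equations *)

Section EnergyDecay.
Context {R : realType}.
Local Notation mu := (@lebesgue_measure R).
Local Notation L := (@Lambda R).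
Local Notation bm := bounded_measurable.
Variables (K : R -> R -> R) (B : R).
Hypothesis cK : continuous (fun p : R * R => K p.1 p.2).
Hypothesis mK : measurable_fun setT (fun p : R * R => K p.1 p.2).
Hypothesis B0 : 0 <= B.
Hypothesis KB : forall u v : R, -2 <= u <= 2 -> -2 <= v <= 2 -> `|K u v| <= B.
Variables (beta T : R) (a : R -> R) (q : R -> R -> R).
Hypothesis hbeta : small_coupling B beta.
Hypothesis T0 : 0 < T.
Hypothesis da : density a.
Hypothesis mq : measurable_fun ((`[0, T] : set R) `*` L) (fun p : R * R => q p.1 p.2).
Hypothesis q01 : forall t u, 0 <= q t u <= 1.

Let S : set R := `[0, T]%classic.

Lemma bm_parametric_integral (g : R -> R -> R) (M : R) :
  measurable_fun (S `*` L) (fun p : R * R => g p.1 p.2) ->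
  (forall t u, S t -> L u -> `|g t u| <= M) ->
  bm S (fun t => \int[mu]_(u in L) g t u).
Proof.
move=> mg gM; split.
  by apply: (measurable_parametric_integral _ mg gM); exact: measurable_itv.
exists (2 * M) => t St.
have bg : bm L (g t) by apply: (bm_section _ mg gM) => //; exact: measurable_itv.
apply: le_trans (normr_RintegralL_le bg (bm_norm bg) _) _ => //.
by apply: L1_bound => // u Lu; exact: gM.
Qed.

Lemma measurable_snd_density (f : R -> R) : bm L f ->
  measurable_fun (S `*` L) (fun p : R * R => f p.2).
Proof.
move=> [mf _]; apply: (@measurable_comp _ _ _ _ _ _ L f (S `*` L) snd) => //.
- exact: measurable_Lambda.
- by move=> _ [[x y] [_ Ly] <-].
- exact: measurable_funTS.
Qed.

Lemma density_section t : S t -> density (q t).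
Proof.
move=> St; split; last by move=> u _; exact: q01.
have : bm L (q t); last by case.
apply: (@bm_section _ _ _ S q 1) => //; first exact: measurable_itv.
by move=> x u _ _; rewrite ger0_norm; have /andP[] := q01 x u.
Qed.

(** The nonlocal factor is an integral over v with the pair (t, u) as parameter. *)
Lemma measurable_flux :
  measurable_fun (S `*` L) (fun p : R * R => flux K (q p.1) p.2).
Proof.
have mS : measurable S by exact: measurable_itv.
have mL := @measurable_Lambda R.
apply: measurable_funM.
  rewrite /sigma; apply: measurable_funM.
    by apply: measurable_funM => //; exact: measurable_cst.
  by apply: measurable_funB => //; exact: measurable_cst.
pose g (x : R * R) (v : R) := K x.2 v * q x.1 v.
apply: (@measurable_parametric_integral _ _ (R * R)%type (S `*` L) g (B * 1)).
- exact: measurableX.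
- have m12 : measurable_fun setT (fun p : (R * R) * R => (p.1.2, p.2)).
    by apply: measurable_fun_pair => //; apply: measurableT_comp.
  have m11 : measurable_fun setT (fun p : (R * R) * R => (p.1.1, p.2)).
    by apply: measurable_fun_pair => //; apply: measurableT_comp.
  apply: measurable_funM.
    exact: measurable_funTS (measurableT_comp mK m12).
  apply: (@measurable_comp _ _ _ _ _ _ (S `*` L) (fun p : R * R => q p.1 p.2)
    ((S `*` L) `*` L) (fun p : (R * R) * R => (p.1.1, p.2))) => //.
  + exact: measurableX.
  + by move=> _ [[[t u] v] [[/= St Lu] Lv] <-].
  + exact: measurable_funTS.
- move=> [t u] v [/= St Lu] Lv; rewrite /g /= normrM ler_pM//.
    by apply: KB; exact: Lambda_in2.
  by rewrite ger0_norm; have /andP[] := q01 t v.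
Qed.

Let mdiff : measurable_fun (S `*` L) (fun p : R * R => q p.1 p.2 - a p.2).
Proof. by apply: measurable_funB => //; apply: measurable_snd_density; exact: density_bm.
  Qed.

Let diff_le1 t u : S t -> L u -> `|q t u - a u| <= 1.
Proof.
by move=> _ Lu; have := q01 t u; have := da.2 u Lu; rewrite ler_norml; lra.
Qed.

Let mflux_diff : measurable_fun (S `*` L) (fun p : R * R => flux K (q p.1) p.2 - flux K a
  p.2).
Proof.
apply: measurable_funB; first exact: measurable_flux.
by apply: measurable_snd_density; exact: (bm_flux cK KB).
Qed.

Let flux_diff_le t u : S t -> L u -> `|flux K (q t) u - flux K a u| <= 5 * B.
Proof.
move=> St Lu; have dq := density_section St.
have := flux_diff cK B0 KB dq da (Lambda_in2 Lu) (q01 t u) (da.2 u Lu).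
have bw := bmB (density_bm dq) (density_bm da).
have := L1_bound bw (fun v Lv => diff_le1 St Lv).
have := diff_le1 St Lu.
move: (\int[mu]_(_ in L) _) `|q t u - a u| => I d d1 I1 /le_trans; apply.
apply: (@le_trans _ _ (4 * B * 1 + B / 2 * (2 * 1))); last by lra.
by apply: lerD; apply: ler_wpM2l => //; [exact: mulr_ge0|exact: divr_ge0].
Qed.

Definition sin_coef k t := inner (fun u => q t u - a u) (sin_mode k).
Definition flux_coef k t := inner (fun u => flux K (q t) u - flux K a u) (cos_mode k).

(* Time derivative of the [k]-th sine coefficient along the flow. *)
Definition mode_rhs k t :=
  - freq k ^+ 2 * sin_coef k t + beta / 2 * (freq k * flux_coef k t).

Lemma bm_sin_coef k : bm S (sin_coef k).
Proof.
apply: (@bm_parametric_integral (fun t u => (q t u - a u) * sin_mode k u) (1 * 1)).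
  by apply: measurable_funM => //; apply: measurable_snd_density; exact: bm_sin_mode.
move=> t u St Lu; rewrite normrM ler_pM ?diff_le1//.
by rewrite ler_norml sin_geN1 sin_le1.
Qed.

Lemma bm_flux_coef k : bm S (flux_coef k).
Proof.
apply: (@bm_parametric_integral (fun t u => (flux K (q t) u - flux K a u) * cos_mode k u)
  (5 * B * 1)).
  by apply: measurable_funM => //; apply: measurable_snd_density; exact: bm_cos_mode.
move=> t u St Lu; rewrite normrM ler_pM ?flux_diff_le//.
by rewrite ler_norml cos_geN1 cos_le1.
Qed.

Lemma bm_mode_rhs k : bm S (mode_rhs k).
Proof.
apply: bmD; apply: bmZ; first exact: bm_sin_coef.
by apply: bmZ; exact: bm_flux_coef.
Qed.

Lemma bm_sqr_dist : bm S (fun t => sqr_dist (q t) a).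
Proof.
apply: (@bm_parametric_integral (fun t u => (q t u - a u) * (q t u - a u)) (1 * 1)).
  exact: measurable_funM.
by move=> t u St Lu; rewrite normrM ler_pM ?diff_le1.
Qed.

(** Half of the dissipation -2 l^2 A^2 absorbs the cross term by completing the square; the other
    half is at most -A^2 because l >= 1. *)
Lemma sin_coef_rhs_le k t :
  2 * (sin_coef k t * mode_rhs k t) <=
  - sin_coef k t ^+ 2 + (beta / 2) ^+ 2 * flux_coef k t ^+ 2.
Proof.
rewrite /mode_rhs; have f1 := @freq_ge1 R k.
move: (sin_coef k t) (flux_coef k t) (freq k) f1 => A f l l1.
have h := sqr_ge0 (l * A - beta / 2 * f).
have h2 : A ^+ 2 <= l ^+ 2 * A ^+ 2.
  by rewrite ler_peMl ?sqr_ge0// -[1](expr1n _ 2) lerXn2r ?nnegrE//; lra.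
have -> : 2 * (A * (- l ^+ 2 * A + beta / 2 * (l * f))) =
  - (l ^+ 2 * A ^+ 2) + (beta / 2) ^+ 2 * f ^+ 2 - (l * A - beta / 2 * f) ^+ 2.
  by move: (beta) => b; field.
lra.
Qed.

Variable z : R -> R -> R.
Hypothesis dz : forall t, 0 <= t <= T -> density (z t).
Hypothesis zq : {ae mu, forall t, 0 <= t <= T -> z t = q t %[ae mu in L]}.
Hypothesis hz : forall k t, 0 <= t <= T ->
  inner (z t) (sin_mode k) - inner (z 0) (sin_mode k) =
  \int[mu]_(x in `[0, t]) mode_rhs k x.

(** Two versions of the flow are in play: [q] is jointly measurable, so its time integrals make
    sense, but it represents the flow only for almost every time; [z] is meaningful at each time, as
    needed for increments. *)
Let zcoef k t := inner (fun u => z t u - a u) (sin_mode k).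

Let zcoef_ae k : {ae mu, forall t, 0 <= t <= T -> zcoef k t = sin_coef k t}.
Proof.
apply: filterS zq => t h ht; apply: ae_eq_inner; last exact: ae_eq_refl.
by apply: filterS (h ht) => u hu Lu; rewrite hu.
Qed.

Let sqr_dist_ae : {ae mu, forall t, 0 <= t <= T -> sqr_dist (z t) a = sqr_dist (q t) a}.
Proof.
apply: filterS zq => t h ht.
by apply: ae_eq_inner; apply: filterS (h ht) => u hu Lu; rewrite hu.
Qed.

Let zcoef_sqr k s t : 0 <= s -> s <= t -> t <= T ->
  zcoef k t ^+ 2 - zcoef k s ^+ 2 <=
  \int[mu]_(x in `[s, t]) (- sin_coef k x ^+ 2 + (beta / 2) ^+ 2 * flux_coef k x ^+ 2).
Proof.
move=> s0 st tT.
have TT : 0 <= (0 : R) <= T by rewrite lexx ltW.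
have inc x : 0 <= x <= T -> zcoef k x - zcoef k 0 = \int[mu]_(x in `[0, x]) mode_rhs k x.
  move=> hx; rewrite -hz// /zcoef !innerBl//; try exact: bm_sin_mode; try exact: density_bm.
  - by ring.
  - by apply: density_bm; exact: dz.
  - by apply: density_bm; exact: dz.
rewrite (sqr_primitive T0 (bm_mode_rhs k) inc s0 st tT).
have b1 : bm `[s, t] (sin_coef k) by exact: bm_itv_sub (bm_sin_coef k).
have b2 : bm `[s, t] (mode_rhs k) by exact: bm_itv_sub (bm_mode_rhs k).
have b3 : bm `[s, t] (flux_coef k) by exact: bm_itv_sub (bm_flux_coef k).
have -> : \int[mu]_(x in `[s, t]) (2 * (zcoef k x * mode_rhs k x)) =
  \int[mu]_(x in `[s, t]) (2 * (sin_coef k x * mode_rhs k x)).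
  apply: ae_eq_Rintegral; apply: filterS (zcoef_ae k) => x hx /=.
  by rewrite in_itv/= => /andP[sx xt]; rewrite hx// (le_trans s0 sx) (le_trans xt tT).
apply: le_Rintegral => //.
- by apply: bm_itv_integrable; apply: bmZ; exact: bmM.
- by apply: bm_itv_integrable; apply: bmD; [apply: bmN; exact: bmX2|apply: bmZ; exact:
  bmX2].
- by move=> x _; exact: sin_coef_rhs_le.
Qed.

Let partial N x := \sum_(k < N) sin_coef k x ^+ 2.

Let bm_partial N : bm S (partial N).
Proof. by apply: bm_sum => k; apply: bmX2; exact: bm_sin_coef. Qed.

(** For each finite N, Bessel already bounds the flux coefficients by the whole squared flux
    distance, so no infinite sum is exchanged with the time integral at this stage. *)
Let partial_sum_increment N s t : 0 <= s -> s <= t -> t <= T ->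
  \sum_(k < N) zcoef k t ^+ 2 - \sum_(k < N) zcoef k s ^+ 2 <=
  \int[mu]_(x in `[s, t]) (2^-1 * sqr_dist (q x) a - partial N x).
Proof.
move=> s0 st tT.
have b1 k : bm `[s, t] (sin_coef k) by exact: bm_itv_sub (bm_sin_coef k).
have b3 k : bm `[s, t] (flux_coef k) by exact: bm_itv_sub (bm_flux_coef k).
have bY : bm `[s, t] (fun x => sqr_dist (q x) a) by exact: bm_itv_sub bm_sqr_dist.
have bP : bm `[s, t] (partial N) by exact: bm_itv_sub (bm_partial N).
have bk k : bm `[s, t] (fun x => - sin_coef k x ^+ 2 + (beta / 2) ^+ 2 * flux_coef k x ^+
  2).
  by apply: bmD; [apply: bmN; exact: bmX2|apply: bmZ; exact: bmX2].
rewrite -sumrB.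
apply: (@le_trans _ _ (\sum_(k < N) \int[mu]_(x in `[s, t])
    (- sin_coef k x ^+ 2 + (beta / 2) ^+ 2 * flux_coef k x ^+ 2))).
  by apply: ler_sum => k _; exact: zcoef_sqr.
have -> : \sum_(k < N) \int[mu]_(x in `[s, t])
    (- sin_coef k x ^+ 2 + (beta / 2) ^+ 2 * flux_coef k x ^+ 2) =
  \int[mu]_(x in `[s, t]) \sum_(k < N) (- sin_coef k x ^+ 2 + (beta / 2) ^+ 2 * flux_coef
    k x ^+ 2).
  elim: N {bP} => [|N IH].
    rewrite big_ord0; under eq_Rintegral do rewrite big_ord0.
    by rewrite Rintegral_itv_cst// mul0r.
  rewrite big_ord_recr /= IH -RintegralD//; first last.
  - exact: bm_itv_integrable.
  - by apply: bm_itv_integrable; exact: bm_sum.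
  by apply: eq_Rintegral => x _; rewrite big_ord_recr.
apply: le_Rintegral => //.
- by apply: bm_itv_integrable; exact: bm_sum.
- by apply: bm_itv_integrable; apply: bmB => //; exact: bmZ.
move=> x /=; rewrite in_itv/= => /andP[sx xt].
have Sx : S x by rewrite /S/= in_itv/= (le_trans s0 sx) (le_trans xt tT).
rewrite big_split /= sumrN addrC lerD2r -mulr_sumr.
have dq := density_section Sx.
apply: le_trans (sqr_dist_scaled_flux cK B0 KB hbeta dq da).
rewrite ler_wpM2l ?sqr_ge0//.
apply: (bessel (@bm_cos_mode R) (@cos_mode_orthonormal R)).
by apply: bmB; exact: (bm_flux cK KB).
Qed.

(** The limit N to infinity: Parseval at the two end times, and dominated convergence for the time
    integral, where Bessel bounds the partial sums. The coefficient is 1/2 - 1 = -1/2. *)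
Let energy_increment s t : 0 <= s -> s <= t -> t <= T ->
  sqr_dist (z t) a - sqr_dist (z s) a <=
  - (2^-1 * \int[mu]_(x in `[s, t]) sqr_dist (q x) a).
Proof.
move=> s0 st tT.
have ht : 0 <= t <= T by rewrite (le_trans s0 st).
have hs : 0 <= s <= T by rewrite s0 (le_trans st tT).
have bY : bm `[s, t] (fun x => sqr_dist (q x) a) by exact: bm_itv_sub bm_sqr_dist.
have bz x : 0 <= x <= T -> bm L (fun u => z x u - a u).
  by move=> hx; apply: bmB; apply: density_bm => //; exact: dz.
have c1 : \sum_(k < N) zcoef k t ^+ 2 - \sum_(k < N) zcoef k s ^+ 2 @[N --> \oo]
    --> sqr_dist (z t) a - sqr_dist (z s) a.
  by apply: cvgB; [exact: (parseval (bz t ht))|exact: (parseval (bz s hs))].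
have Sx x : `[s, t]%classic x -> S x.
  by rewrite /S/= !in_itv/= => /andP[sx xt]; rewrite (le_trans s0 sx) (le_trans xt tT).
have bq x : S x -> bm L (fun u => q x u - a u).
  by move=> hx; apply: bmB; apply: density_bm => //; exact: density_section.
have partial_le N x : S x -> partial N x <= sqr_dist (q x) a.
  by move=> hx; apply: (bessel (@bm_sin_mode R) (@sin_mode_orthonormal R)); exact: bq.
have partial_ge0 N x : 0 <= partial N x by apply: sumr_ge0 => k _; exact: sqr_ge0.
have [mY [M YM]] := bY.
have c2 : \int[mu]_(x in `[s, t]) (2^-1 * sqr_dist (q x) a - partial N x) @[N --> \oo]
    --> \int[mu]_(x in `[s, t]) (2^-1 * sqr_dist (q x) a - sqr_dist (q x) a).
  apply: (@bounded_cvg_Rintegral _ _ _ _ (2 * M)) => //.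
  - by rewrite [X in (X < _)%E]mu_itvcc// ltry.
  - move=> N; have : bm `[s, t] (fun x => 2^-1 * sqr_dist (q x) a - partial N x); last by
    case.
    by apply: bmB; [exact: bmZ|exact: bm_itv_sub (bm_partial N)].
  - have : bm `[s, t] (fun x => 2^-1 * sqr_dist (q x) a - sqr_dist (q x) a); last by case.
    by apply: bmB => //; exact: bmZ.
  - move=> N x hx; have := YM x hx.
    have := partial_le N x (Sx x hx); have := partial_ge0 N x.
    move: (partial N x) (sqr_dist (q x) a) => p Y p0 pY.
    by rewrite ger0_norm ?ler_norml; lra.
  - move=> x hx; apply: cvgB; first exact: cvg_cst.
    exact: (parseval (bq x (Sx x hx))).
have := ler_cvg_to c1 c2.
have -> : \int[mu]_(x in `[s, t]) (2^-1 * sqr_dist (q x) a - sqr_dist (q x) a) =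
   - (2^-1 * \int[mu]_(x in `[s, t]) sqr_dist (q x) a).
  rewrite -RintegralZl//; last exact: bm_itv_integrable.
  rewrite -[RHS]mulN1r -RintegralZl//; last by apply: bm_itv_integrable; exact: bmZ.
  by apply: eq_Rintegral => x _; field.
apply; apply: nearW => N; exact: partial_sum_increment.
Qed.

Lemma energy_decay : sqr_dist (z T) a <= expR (- (T / 4)) * sqr_dist (z 0) a.
Proof.
apply: (@integral_gronwall _ (fun t => sqr_dist (z t) a) (fun t => sqr_dist (q t) a) T T0).
- exact: bm_sqr_dist.
- by move=> t; exact: inner_ge0.
- exact: sqr_dist_ae.
- by move=> t _; exact: inner_ge0.
- exact: energy_increment.
Qed.

End EnergyDecay.

(** * From the weak evolution equation to the mode equations *)

Section EvolutionWeakForm.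
Context {R : realType}.
Local Notation mu := (@lebesgue_measure R).
Local Notation L := (@Lambda R).
Local Notation bm := bounded_measurable.

Lemma continuous_snd_comp (f : R -> R) : continuous f ->
  continuous (fun p : R * R => f p.2).
Proof. by move=> cf p; apply: (continuous_comp (@cvg_snd _ _ _ _ _)); exact: cf. Qed.

(** Time-independent test functions remove the time-derivative term, so the weak form becomes the
    time-integrated equation of a single coefficient. *)
Lemma C2_0_C12_0 (T : R) (G G1 G2 : R -> R) :
  continuous G -> continuous G1 -> continuous G2 -> C2_0 G G1 G2 ->
  C12_0 T (fun=> G) (fun _ => cst 0) (fun=> G1) (fun=> G2).
Proof.
move=> cG cG1 cG2 [_ [dG dG1 bG]]; split; split.
- by apply: continuous_subspaceT; exact: continuous_snd_comp.
- by apply: continuous_subspaceT; exact: cst_continuous.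
- by apply: continuous_subspaceT; exact: continuous_snd_comp.
- by apply: continuous_subspaceT; exact: continuous_snd_comp.
- by move=> t u _ _; exact: is_derive_cst.
- by move=> t u _ Lu; exact: dG.
- by move=> t u _ Lu; exact: dG1.
- by move=> t _.
Qed.

Lemma flux_ae (K : R -> R -> R) m m' : m = m' %[ae mu in L] ->
  flux K m = flux K m' %[ae mu in L].
Proof.
move=> mm'; have h u : nonlocal_grad K m u = nonlocal_grad K m' u.
  by apply: ae_eq_Rintegral; apply: filterS mm' => v hv Lv; rewrite hv.
by apply: filterS mm' => u hu Lu; rewrite /flux hu// h.
Qed.

Lemma in_M_Lambda (m : R -> R) : in_M m ->
  measurable_fun L m /\ {ae mu, forall u, L u -> 0 <= m u <= 1}.
Proof.
move=> [mm m01]; split.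
  by apply: measurable_funS mm; [exact: measurable_itv|exact: Lambda_subset].
by apply: filterS m01 => u h /Lambda_subset; exact: h.
Qed.

Lemma ae_neq0 : {ae mu, forall t : R, t != 0}.
Proof.
exists [set 0]; split; [exact: measurable_set1|exact: lebesgue_measure_set1|].
by move=> t /= /negP; rewrite negbK => /eqP.
Qed.

Variables (J K : R -> R -> R) (B : R).
Hypothesis cK : continuous (fun p : R * R => K p.1 p.2).
Hypothesis mK : measurable_fun setT (fun p : R * R => K p.1 p.2).
Hypothesis B0 : 0 <= B.
Hypothesis KB : forall u v : R, -2 <= u <= 2 -> -2 <= v <= 2 -> `|K u v| <= B.
Hypothesis cJ : continuous (fun p : R * R => Jneum J p.1 p.2).
Hypothesis dJ : forall u v : R, is_derive u 1 (fun x => Jneum J x v) (K u v).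
Variables (beta rhom rhop : R) (a rho0 : R -> R) (rho : R -> R -> R).
Hypothesis hbeta : small_coupling B beta.
Hypothesis da : density a.
Hypothesis modes_a : stationary_modes K beta rhom rhop a.
Hypothesis M0 : in_M rho0.
Hypothesis evo : evolution_solution J beta rhom rhop rho0 rho.

(* Representative of the solution with values in [0, 1] everywhere; at time 0
   it is the initial datum, which the weak formulation does not identify with
   [rho 0]. *)
Definition clamped_flow (t : R) : R -> R :=
  if t == 0 then clamp01 \o rho0 else clamp01 \o rho t.

Let z := clamped_flow.

Let rho_in_M t : 0 < t -> in_M (rho t).
Proof. by move=> t0; have [[h _ _] _ _] := evo t0; apply: h; rewrite ltW//= lexx. Qed.

Let z0 : z 0 = clamp01 \o rho0. Proof. by rewrite /z /clamped_flow eqxx. Qed.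

Let zE t : 0 < t -> z t = clamp01 \o rho t.
Proof. by move=> t0; rewrite /z /clamped_flow gt_eqF. Qed.

Lemma density_clamped_flow t : 0 <= t -> density (clamped_flow t).
Proof.
rewrite le_eqVlt => /predU1P[<-|t0]; rewrite -/(z _).
  by rewrite z0; apply: density_clamp01; have [] := in_M_Lambda M0.
by rewrite zE//; apply: density_clamp01; have [] := in_M_Lambda (rho_in_M t0).
Qed.

(** A solution satisfies its weak formulation up to every final time, so [t] itself is taken as the
    horizon and no cut-off in time is needed. Subtracting [t] times the stationary mode identity
    removes the boundary terms and leaves the equation of the difference. *)
Lemma clamped_flow_modes (T : R) : 0 < T -> exists q : R -> R -> R,
  [/\ measurable_fun ((`[0, T] : set R) `*` L) (fun p : R * R => q p.1 p.2),
      forall t u, 0 <= q t u <= 1,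
      {ae mu, forall t, 0 <= t <= T -> clamped_flow t = q t %[ae mu in L]} &
      forall k t, 0 <= t <= T ->
        inner (clamped_flow t) (@sin_mode R k) - inner (clamped_flow 0) (@sin_mode R k) =
        \int[mu]_(x in `[0, t]) mode_rhs K beta a q k x].
Proof.
move=> T0; have [cad [r [d [mr _ rae _]]] _] := evo T0.
pose q t u := clamp01 (r t u).
have mq : measurable_fun ((`[0, T] : set R) `*` L) (fun p : R * R => q p.1 p.2).
  exact: (measurableT_comp measurable_clamp01 mr).
have q01 t u : 0 <= q t u <= 1 by exact: clamp01_in.
have zq : {ae mu, forall t, 0 <= t <= T -> z t = q t %[ae mu in L]}.
  apply: filterS2 rae ae_neq0 => t h tn0 ht.
  have t0 : 0 < t by rewrite lt_neqAle eq_sym tn0; case/andP: ht.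
  have [h1 _] := h ht; rewrite zE//.
  by apply: filterS h1 => u hu Lu; rewrite /= hu.
exists q; split => // k t /andP[]; rewrite -/z le_eqVlt => /predU1P[<- _|t0 tT].
  by rewrite subrr set_itv1 Rintegral_set1.
have [_ _ weak] := evo t0.
have cZ (c : R) (f : R -> R) : continuous f -> continuous (fun u => c * f u).
  by move=> cf u; apply: cvgM; [exact: cvg_cst|exact: cf].
have cs := @continuous_sin_mode R k; have cc := @continuous_cos_mode R k.
have cs2 : continuous (fun u : R => freq k * - (freq k * sin_mode k u)).
  apply: (cZ) => u; apply: cvgN; exact: (cZ).
have := weak _ _ _ _ (C2_0_C12_0 t cs (cZ _ _ cc) cs2 (sin_mode_C2_0 k)).
have bs := @bm_sin_mode R k; have bc := @bm_cos_mode R k.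
have ba := density_bm da; have bfa := bm_flux cK KB da.
have [mrt rt01] := in_M_Lambda (rho_in_M t0).
have [mr0 r001] := in_M_Lambda M0.
have -> : inner (rho t) (sin_mode k) = inner (z t) (sin_mode k).
  by rewrite zE//; apply: ae_eq_inner; [exact: clamp01_ae|exact: ae_eq_refl].
have -> : inner rho0 (sin_mode k) = inner (z 0) (sin_mode k).
  by rewrite z0; apply: ae_eq_inner; [exact: clamp01_ae|exact: ae_eq_refl].
have inner0 f : inner f (cst 0) = 0.
  rewrite /inner; under eq_Rintegral do rewrite mulr0.
  by rewrite Rintegral_cst ?mul0r//; exact: measurable_Lambda.
have -> : \int[mu]_(t0 in `[0, t]) inner (rho t0) (cst 0) = 0.
  under eq_Rintegral do rewrite inner0.
  by rewrite Rintegral_itv_cst ?mul0r// ltW.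
have S_sub x : `[0, t]%classic x -> 0 <= x <= T.
  by rewrite /= in_itv/= => /andP[-> /le_trans]; apply.
have dq x : 0 <= x <= T -> density (q x).
  by move=> hx; apply: (density_section mq q01); rewrite /= in_itv.
have bS : bm `[0, t] (sin_coef a q k).
  by apply: bm_itv_sub (bm_sin_coef da mq q01 k).
have bF : bm `[0, t] (flux_coef K a q k).
  by apply: bm_itv_sub (bm_flux_coef cK mK B0 KB da mq q01 k).
pose A := inner a (sin_mode k); pose P := inner (flux K a) (cos_mode k).
have -> : \int[mu]_(x in `[0, t]) inner (rho x) (fun u => freq k * - (freq k * sin_mode k
  u)) =
    (* [sin_coef] measures the distance to [a], so the stationary coefficient [A] is added back; the
       same happens with [P] for the flux. *)
    - freq k ^+ 2 * (\int[mu]_(x in `[0, t]) sin_coef a q k x + A * t).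
  rewrite -[X in _ + A * X](subr0 t) -Rintegral_itv_cst ?ltW// -RintegralD//; first last.
  - by apply: bm_itv_integrable; exact: bm_cst.
  - exact: bm_itv_integrable.
  rewrite -RintegralZl//; last by apply: bm_itv_integrable; apply: bmD => //; exact: bm_cst.
  apply: ae_eq_Rintegral; apply: filterS2 zq ae_neq0 => x hx xn0 /S_sub xT.
  have x0 : 0 < x by rewrite lt_neqAle eq_sym xn0; case/andP: xT.
  have [mrx rx01] := in_M_Lambda (rho_in_M x0).
  have -> : inner (rho x) (fun u => freq k * - (freq k * sin_mode k u)) =
      inner (q x) (fun u => freq k * - (freq k * sin_mode k u)).
    apply: ae_eq_inner; last exact: ae_eq_refl.
    apply: ae_eq_trans (clamp01_ae rx01) _.
    by rewrite -zE//; exact: hx.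
  have bq := density_bm (dq x xT).
  rewrite innerZr//; last by apply: bmN; exact: bmZ.
  rewrite innerNr//; last exact: bmZ.
  rewrite innerZr// /sin_coef innerBl// -/A /=.
  by move: (inner _ _) (freq k) A => i f A'; ring.
have -> : \int[mu]_(x in `[0, t])
      inner (fun u => sigma (rho x u)) (fun u => freq k * cos_mode k u * derive1 (Jstar J
        (rho x)) u) =
    freq k * (\int[mu]_(x in `[0, t]) flux_coef K a q k x + P * t).
  rewrite -[X in _ + P * X](subr0 t) -Rintegral_itv_cst ?ltW// -RintegralD//; first last.
  - by apply: bm_itv_integrable; exact: bm_cst.
  - exact: bm_itv_integrable.
  rewrite -RintegralZl//; last by apply: bm_itv_integrable; apply: bmD => //; exact: bm_cst.
  apply: ae_eq_Rintegral; apply: filterS2 zq ae_neq0 => x hx xn0 /S_sub xT.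
  have x0 : 0 < x by rewrite lt_neqAle eq_sym xn0; case/andP: xT.
  have [mrx rx01] := in_M_Lambda (rho_in_M x0).
  rewrite (inner_drift B0 KB cJ dJ (fun u => freq k * cos_mode k u) mrx rx01) -zE//.
  have bfq := bm_flux cK KB (dq x xT).
  have -> : inner (flux K (z x)) (fun u => freq k * cos_mode k u) =
      inner (flux K (q x)) (fun u => freq k * cos_mode k u).
    by apply: ae_eq_inner; [apply: flux_ae; exact: hx|exact: ae_eq_refl].
  rewrite innerZr// /flux_coef innerBl// -/P /=.
  by move: (inner _ _) P (freq k) => i P' f; ring.
have ci c : \int[mu]_(x in `[0, t]) c = c * t :> R.
  by rewrite (Rintegral_itv_cst c (ltW t0)) subr0.
rewrite !ci.
have -> : \int[mu]_(x in `[0, t]) mode_rhs K beta a q k x =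
    - freq k ^+ 2 * \int[mu]_(x in `[0, t]) sin_coef a q k x +
    beta / 2 * (freq k * \int[mu]_(x in `[0, t]) flux_coef K a q k x).
  rewrite RintegralD//; first last.
  - by apply: bm_itv_integrable; apply: bmZ; exact: bmZ.
  - by apply: bm_itv_integrable; exact: bmZ.
  have ZE c f : bm `[0, t] f -> \int[mu]_(x in `[0, t]) (c * f x) = c * \int[mu]_(x in
    `[0, t]) f x.
    by move=> bf; rewrite RintegralZl//; exact: bm_itv_integrable.
  by rewrite !ZE//; exact: bmZ.
have := modes_a k; rewrite -/A -/P.
move: (inner (z t) _) (inner (z 0) _) (\int[mu]_(x in _) sin_coef _ _ _ _) (\int[mu]_(x
  in _) flux_coef _ _ _ _ _).
move: (freq k) A P (cos_mode k 1) (cos_mode k (-1)) => f A P c1 c2 zt zz I1 I2 E W.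
have Et : t * (f ^+ 2 * A + rhop * (f * c1) - rhom * (f * c2) - beta / 2 * (f * P)) = 0.
  by rewrite E mulr0.
move: Et W; move: (beta / 2) => b Et W.
have WE := f_equal2 (fun x y : R => x - y) W Et.
apply/eqP; rewrite -subr_eq0; apply/eqP.
by rewrite -[RHS](subr0 0) -[RHS]WE; ring.
Qed.

Lemma evolution_decay (t : R) : 0 < t ->
  sqr_dist (clamped_flow t) a <= expR (- (t / 4)) * sqr_dist (clamped_flow 0) a.
Proof.
move=> t0; have [q [mq q01 zq hz]] := clamped_flow_modes t0.
apply: (energy_decay cK mK B0 KB hbeta t0 da mq q01 _ zq hz).
by move=> s /andP[s0 _]; exact: density_clamped_flow.
Qed.

End EvolutionWeakForm.

(** * Identification of the initial datum *)

Section InitialTime.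
Context {R : realType}.
Local Notation mu := (@lebesgue_measure R).
Local Notation L := (@Lambda R).
Local Notation bm := bounded_measurable.
Variables (J K : R -> R -> R) (B : R).
Hypothesis cK : continuous (fun p : R * R => K p.1 p.2).
Hypothesis mK : measurable_fun setT (fun p : R * R => K p.1 p.2).
Hypothesis B0 : 0 <= B.
Hypothesis KB : forall u v : R, -2 <= u <= 2 -> -2 <= v <= 2 -> `|K u v| <= B.
Hypothesis cJ : continuous (fun p : R * R => Jneum J p.1 p.2).
Hypothesis dJ : forall u v : R, is_derive u 1 (fun x => Jneum J x v) (K u v).
Variables (beta rhom rhop : R) (a rho0 : R -> R) (rho : R -> R -> R).
Hypothesis da : density a.
Hypothesis modes_a : stationary_modes K beta rhom rhop a.
Hypothesis M0 : in_M rho0.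
Hypothesis evo : evolution_solution J beta rhom rhop rho0 rho.

(** All partial Parseval sums of the difference are 0, hence so is their limit, its squared norm. *)
Lemma sine_coefs_eq (f g : R -> R) : bm L f -> bm L g ->
  (forall k, inner f (sin_mode k) = inner g (sin_mode k)) -> f = g %[ae mu in L].
Proof.
move=> bf bg fg.
have bw := bmB bf bg.
have : inner (fun u => f u - g u) (fun u => f u - g u) = 0.
  have := parseval bw.
  have -> : (fun N => \sum_(k < N) inner (fun u => f u - g u) (sin_mode k) ^+ 2) = cst 0.
    apply/funext => N; rewrite big1// => k _.
    rewrite innerBl//; last exact: bm_sin_mode.
    by rewrite fg subrr expr0n.
  by move=> h; apply: (cvg_unique _ h); [exact: Rhausdorff|exact: cvg_cst].
move/(ae_eq_inner0 bw); apply: filterS => u h Lu.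
by apply/eqP; rewrite -subr_eq0; apply/eqP; exact: h.
Qed.

(* Weak right-continuity at 0 together with the weak formulation. *)
Lemma evolution_initial : rho 0 = rho0 %[ae mu in L].
Proof.
have [cad _ _] := evo (@ltr01 R).
have [Mt rc _] := cad.
have [q [mq q01 zq hz]] := clamped_flow_modes cK mK B0 KB cJ dJ da modes_a M0 evo (@ltr01
  R).
have [mr0 r001] := in_M_Lambda M0.
have M00 : in_M (rho 0) by apply: Mt; rewrite lexx ler01.
have [mr r01] := in_M_Lambda M00.
have b0 := density_bm (density_clamp01 mr0).
have b := density_bm (density_clamp01 mr).
suff h : clamp01 \o rho 0 = clamp01 \o rho0 %[ae mu in L].
  apply: ae_eq_trans (clamp01_ae r01) _; apply: ae_eq_trans h _.
  exact: ae_eq_sym (clamp01_ae r001).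
apply: sine_coefs_eq => // k.
have -> : inner (clamp01 \o rho 0) (sin_mode k) = inner (rho 0) (sin_mode k).
  by apply: ae_eq_inner; [exact: ae_eq_sym (clamp01_ae r01)|exact: ae_eq_refl].
have c1 : inner (rho s) (sin_mode k) @[s --> 0^'+] --> inner (rho 0) (sin_mode k).
  apply: rc; first by rewrite lexx ltr01.
  by apply: continuous_subspaceT; exact: continuous_sin_mode.
(* The same coefficient has a second limit: its distance to that of [rho0] is the integral of the
   bounded [mode_rhs] over [0,s], of order s. *)
apply: (cvg_unique _ c1); first exact: Rhausdorff.
have bH : bm `[0, 1] (mode_rhs K beta a q k).
  exact: (bm_mode_rhs cK mK B0 KB beta da mq q01 k).
have [_ [M HM]] := bH.
apply/cvgrPdist_le => e e0.
have M1 : 0 < `|M| + 1 by rewrite ltr_pwDr.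
near=> s.
have s0 : 0 < s by near: s; exact: nbhs_right_gt.
have s1 : s <= 1 by near: s; apply: nbhs_right_le.
have se : s <= e / (`|M| + 1) by near: s; apply: nbhs_right_le; rewrite divr_gt0.
have s01 : 0 <= s <= 1 by rewrite ltW.
have [_ rs01] := in_M_Lambda (Mt s s01).
have -> : inner (rho s) (sin_mode k) = inner (clamped_flow rho0 rho s) (sin_mode k).
  rewrite /clamped_flow gt_eqF//.
  by apply: ae_eq_inner; [exact: clamp01_ae|exact: ae_eq_refl].
have := hz k s s01; rewrite {2}/clamped_flow eqxx => E.
rewrite distrC E.
have bs : bm `[0, s] (mode_rhs K beta a q k) by exact: bm_itv_sub bH.
apply: le_trans (normr_Rintegral_itv_le (ltW s0) bs _) _.
  move=> x /andP[x0 xs]; apply: (HM x); rewrite /= in_itv/= x0/=.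
  exact: le_trans xs s1.
rewrite subr0; apply: (@le_trans _ _ ((`|M| + 1) * s)).
  by rewrite ler_wpM2r ?(ltW s0)// (le_trans (ler_norm M))// lerDl.
by rewrite mulrC -ler_pdivlMr.
Unshelve. all: by end_near. Qed.

End InitialTime.

Lemma L2norm_sub (R : realType) (f g f' g' : R -> R) : density f' -> density g' ->
  f = f' %[ae (@lebesgue_measure R) in Lambda] ->
  g = g' %[ae (@lebesgue_measure R) in Lambda] ->
  L2norm (f \- g) = (Num.sqrt (sqr_dist f' g'))%:E.
Proof.
move=> df dg ff gg; apply: L2normE; last by apply: bmB; exact: density_bm.
by apply: filterS2 ff gg => u hf hg Lu /=; rewrite hf// hg.
Qed.

Theorem theorem6p2 (R : realType) (J : R -> R -> R) (hJ : admissible_kernel J) :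
  exists2 beta0 : R, 0 < beta0 &
  forall beta : R, 0 <= beta <= beta0 ->
    (forall rhom rhop : R, 0 < rhom < 1 -> 0 < rhop < 1 ->
       exists2 rhobar : R -> R,
         stationary_solution J beta rhom rhop rhobar &
         forall rho : R -> R, stationary_solution J beta rhom rhop rho ->
           rho = rhobar %[ae (@lebesgue_measure R) in Lambda])
    /\
    (beta < beta0 ->
     exists2 c : R, 0 < c &
     forall rhom rhop : R, 0 < rhom < 1 -> 0 < rhop < 1 ->
     forall rhobar : R -> R, stationary_solution J beta rhom rhop rhobar ->
     forall rho0 : R -> R, in_M rho0 ->
     forall rho : R -> R -> R, evolution_solution J beta rhom rhop rho0 rho ->
     forall t : R, 0 <= t ->
       (L2norm (rho t \- rhobar)%R
          <= (expR (- c * t))%:E * L2norm (rho0 \- rhobar)%R)%E).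
Proof.
have [sJ _ _ tJ _] := hJ.
have [K [cK mK cJ dJ]] := Jneum_gradient sJ tJ.
have [B B0 KB] := continuous_bounded_square cK.
have B1 : 0 < 20 * (B + 1) by rewrite mulr_gt0// ltr_pwDr.
(* The summand 1 keeps the denominator positive even when B = 0. *)
exists (20 * (B + 1))^-1; first by rewrite invr_gt0.
move=> beta /andP[beta0 betaB].
have sb : small_coupling B beta.
  by split => //; rewrite -ler_pdivlMr// mul1r.
split=> [rhom rhop hm hp|_].
  have [rhobar sbar] := stationary_solution_exists cK B0 KB cJ dJ sb hm hp.
  exists rhobar => // rho srho.
  have [mb eb modes_b] := stationary_solution_modes cK B0 KB cJ dJ sbar.
  have [mr er modes_r] := stationary_solution_modes cK B0 KB cJ dJ srho.
  have h := stationary_modes_unique cK B0 KB sb (density_clamp01 mr) (density_clamp01 mb)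
    modes_r modes_b.
  apply: ae_eq_trans er _; apply: ae_eq_trans h _; exact: ae_eq_sym.
(* The squared distance decays at rate 1/4; the square root halves it. *)
exists 8^-1; first by rewrite invr_gt0.
move=> rhom rhop _ _ rhobar sbar rho0 M0 rho evo t t0.
have [mb eb modes_b] := stationary_solution_modes cK B0 KB cJ dJ sbar.
have da := density_clamp01 mb.
have [mr0 r001] := in_M_Lambda M0.
have d0 := density_clamp01 mr0.
have n0 : L2norm (rho0 \- rhobar) = (Num.sqrt (sqr_dist (clamp01 \o rho0) (clamp01 \o
  rhobar)))%:E.
  by apply: L2norm_sub => //; exact: clamp01_ae.
(* Time 0 is separate: [clamped_flow] starts from the datum [rho0], whereas the claim there concerns
   [rho 0]. *)
move: t0; rewrite le_eqVlt => /predU1P[<-|t0].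
  rewrite mulr0 expR0 mul1e n0 (@L2norm_sub _ _ _ (clamp01 \o rho0) (clamp01 \o rhobar))//.
  apply: ae_eq_trans (evolution_initial cK mK B0 KB cJ dJ da modes_b M0 evo) _.
  exact: clamp01_ae.
have [cad _ _] := evo t t0.
have [mrt rt01] : measurable_fun Lambda (rho t) /\ {ae (@lebesgue_measure R), forall u,
  Lambda u -> 0 <= rho t u <= 1}.
  by apply: in_M_Lambda; case: cad => h _ _; apply: h; rewrite lexx ltW.
rewrite n0 (@L2norm_sub _ _ _ (clamp01 \o rho t) (clamp01 \o rhobar))//; last 2 first.
- exact: density_clamp01.
- exact: clamp01_ae.
have := evolution_decay cK mK B0 KB cJ dJ sb da modes_b M0 evo t0.
rewrite /clamped_flow eqxx gt_eqF// => h.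
rewrite -EFinM lee_fin.
apply: le_trans (ler_wsqrtr h) _.
rewrite sqrtrM ?expR_ge0//.
have -> : expR (- (t / 4)) = expR (- 8^-1 * t) ^+ 2.
  by rewrite expr2 -expRD; congr expR; field.
by rewrite sqrtr_sqr ger0_norm ?expR_ge0.
Qed.
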